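(* Let $k\ge4$ and let $P_k^{\mathsf{bb}}(x_1,x_{k+1})=R_1(x_1,x_2)\wedge R_2(x_2,x_3)\wedge\dots\wedge R_k(x_k,x_{k+1})$ with $x_1,x_{k+1}$ bound. For any input database $D$ and any $\Delta\ge\sqrt{|D|}$, there is a data structure for $P_k^{\mathsf{bb}}$ using space $S=O(|D|\cdot\Delta)$ with answering time $T=O\big((|D|/\Delta)^{(k-2)/2}\big)$.
   Context: $R_1,\dots,R_k$ are binary relations in the database $D$; $|D|$ is the total number of tuples. An access request assigns constants $a,b$ to $x_1,x_{k+1}$ and asks whether there exist values for $x_2,\dots,x_k$ making every atom hold (with $x_1=a$, $x_{k+1}=b$). Space and answering time are measured in the uniform-cost RAM model, with $k$ fixed. *)

(* Defs.v *)
From mathcomp Require Import all_boot all_order all_algebra.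
From mathcomp Require Import finmap.
From mathcomp Require Import reals exp.

Set Implicit Arguments.
Unset Strict Implicit.
Unset Printing Implicit Defensive.

Import Order.TTheory GRing.Theory Num.Theory.

(** ** Databases and path queries *)

(* [D i] is the relation written R_{i+1} in 1-based notation. *)
Definition database (k : nat) := 'I_k -> {fset nat * nat}.

Definition dbsize (k : nat) (D : database k) : nat := \sum_(i < k) #|` D i|.

Definition constants_below (k : nat) (U : nat) (D : database k) : Prop :=
  forall (i : 'I_k) (e : nat * nat), e \in D i -> e.1 < U /\ e.2 < U.

(* The variables x_1, ..., x_{k+1} are [x ord0], ..., [x ord_max]. *)
Definition path_query (k : nat) (D : database k) (a b : nat) : Prop :=
  exists x : 'I_k.+1 -> nat,
    [/\ x ord0 = a, x ord_max = b
      & forall i : 'I_k,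
          (x (widen_ord (leqnSn k) i), x (lift ord0 i)) \in D i].

(** ** The uniform-cost random access machine *)

Inductive binop := Add | Sub | Mul | Div.

(* [Sub] is truncated at 0, [Div] rounds down and [v / 0 = 0]. *)
Definition eval_binop (o : binop) (u v : nat) : nat :=
  match o with
  | Add => u + v
  | Sub => u - v
  | Mul => u * v
  | Div => u %/ v
  end.

(* Registers are direct operands; [Fetch d s] and [Store d s] are the indirect
   accesses r_d := M[r_s] and M[r_d] := r_s. Jump targets are absolute. *)
Inductive instr :=
  | Const (d n : nat)
  | Op (o : binop) (d s1 s2 : nat)
  | Fetch (d s : nat)
  | Store (d s : nat)
  | Jump (l : nat)
  | JumpZero (s l : nat)
  | Halt.

Definition program := seq instr.

Record config := Config {
  pc : nat;
  reg : nat -> nat;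
  mem : seq nat
}.

Definition upd (f : nat -> nat) (d v : nat) : nat -> nat :=
  fun r => if r == d then v else f r.

(* Unit cost per instruction would be meaningless if one word could hold
   arbitrarily much information, so every word produced must be smaller than
   [W]; a larger result, an access outside the memory, or leaving the program
   is a fault ([None]). The memory never grows, hence any scratch space used
   by a program is part of [mem]. *)
Definition set_reg (W : nat) (s : config) (d v : nat) : option config :=
  if v < W then Some (Config (pc s).+1 (upd (reg s) d v) (mem s)) else None.

Definition step (W : nat) (P : program) (s : config) : option config :=
  match onth P (pc s) with
  | Some (Const d n) => set_reg W s d n
  | Some (Op o d s1 s2) =>
      set_reg W s d (eval_binop o (reg s s1) (reg s s2))
  | Some (Fetch d r) =>
      if reg s r < size (mem s)
      then set_reg W s d (nth 0 (mem s) (reg s r)) else None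
  | Some (Store d r) =>
      if reg s d < size (mem s)
      then Some (Config (pc s).+1 (reg s)
                        (set_nth 0 (mem s) (reg s d) (reg s r)))
      else None
  | Some (Jump l) => Some (Config l (reg s) (mem s))
  | Some (JumpZero r l) =>
      Some (Config (if reg s r == 0 then l else (pc s).+1) (reg s) (mem s))
  | Some Halt | None => None
  end.

Fixpoint run (W : nat) (P : program) (t : nat) (s : config) : option config :=
  if t is t'.+1 then obind (run W P t') (step W P s) else Some s.

Definition halted (P : program) (s : config) : Prop :=
  onth P (pc s) = Some Halt.

Definition start (M : seq nat) (a b : nat) : config :=
  Config 0 (upd (upd (fun=> 0) 1 b) 0 a) M.

(* Register 0 holds the Boolean answer. The memory has to be left as it was
   found, so that the same data structure serves any number of requests. *)
Definition answers_in (W : nat) (P : program) (M : seq nat) (a b : nat)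
    (Q : Prop) (t : nat) : Prop :=
  exists s : config,
    [/\ run W P t (start M a b) = Some s, halted P s, mem s = M
      & reg s 0 <> 0 <-> Q].

(* Words of O(log (N + U)) bits, for N tuples over the constants below U. *)
Definition word_bound (c N U : nat) : nat := (N + U + 2) ^ c.

(* Main.v *)
From mathcomp Require Import all_boot all_order all_algebra.
From mathcomp Require Import finmap zify lra.
From mathcomp Require Import reals exp.
Require Import Defs.

Import Order.TTheory GRing.Theory Num.Theory.

(** Let N = |D|, B = N / Delta, and call a vertex heavy if its degree exceeds
   Delta, so that there are at most B <= Delta heavy vertices per relation. For
   every sub-path query between relations i and i + l - 1, the answer is stored
   for those pairs (u, v) with outdeg(u) * indeg(v) > B: at most N^2 / B =
   N * Delta pairs, since the products of degrees sum to at most N^2. For the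
   other pairs one endpoint has degree at most sqrt B; enumerating its
   neighbours shortens the path by one at a cost of sqrt B. This is repeated
   until four relations remain, where
   - the paths through a heavy middle vertex are found by going through the at
     most B heavy vertices h, the 2-path queries (u, h) and (h, v) being stored
     in space N * B <= N * Delta;
   - the others are found by going through the at most outdeg(u) * indeg(v) <= B
     pairs of neighbours of the endpoints, the 2-path queries with a light
     middle vertex being stored in space N * Delta.
   The total time is (sqrt B)^(k - 4) * B = B^((k - 2) / 2).

   All stored tables are merged into one static dictionary with constant access
   time (Fredman, Komlos and Szemeredi). The nested enumerations are run by a
   single counter, whose mixed-radix digits select the neighbours. *)

(** * Primes of polynomial size *)

Lemma leq_expn2_central_bin m : 2 ^ m <= 'C(m.*2, m).
Proof.
elim: m => [|m IHm] //; rewrite doubleS binS expnS mul2n -addnn leq_add //.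
  by rewrite binS (leq_trans IHm) ?leq_addl.
by rewrite (leq_trans IHm) // leq_bin2l.
Qed.

(** By Legendre's formula the exponent of [p] is a sum of differences
    [2m %/ p ^ k - 2 * (m %/ p ^ k)]. Each of them is 0 or 1, and it vanishes once [p ^ k] exceeds
    [2m]. *)
Lemma leq_pfactor_central_bin p m : prime p -> 0 < m ->
  p ^ logn p 'C(m.*2, m) <= m.*2.
Proof.
move=> p_pr m_gt0.
have p_gt1 := prime_gt1 p_pr.
have C_gt0 : 0 < 'C(m.*2, m) by rewrite bin_gt0; lia.
suff le_log : logn p 'C(m.*2, m) <= trunc_log p m.*2.
  by rewrite (leq_trans _ (@trunc_logP p m.*2 p_gt1 _)) ?leq_exp2l //; lia.
have /(congr1 (logn p)) : 'C(m.*2, m) * (m`! * m`!) = m.*2`!.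
  have -> : m`! * m`! = m`! * (m.*2 - m)`! by congr (_ * _`!); lia.
  by rewrite bin_fact //; lia.
rewrite !lognM ?muln_gt0 ?fact_gt0 // !logn_fact //.
have -> : \sum_(1 <= k < m.+1) m %/ p ^ k = \sum_(1 <= k < m.*2.+1) m %/ p ^ k.
  rewrite [RHS](@big_cat_nat _ _ _ m.+1) //=; last by lia.
  rewrite -[LHS]addn0; congr (_ + _); rewrite big_nat big1 // => k /andP[lemk _].
  by rewrite divn_small // (leq_trans lemk) // ltnW // ltn_expl.
set s := \sum_(1 <= k < m.*2.+1) m %/ p ^ k.
have : \sum_(1 <= k < m.*2.+1) m.*2 %/ p ^ k <=
       s + s + \sum_(1 <= k < m.*2.+1) (k <= trunc_log p m.*2).
  rewrite /s -!big_split /= leq_sum // => k _.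
  case: (leqP k (trunc_log p m.*2)) => [_|lt_k].
    have pk0 : 0 < p ^ k by rewrite expn_gt0; lia.
    by rewrite -addnn divnD // leq_add2l; case: (_ <= _ %% _ + _).
  by rewrite divn_small // (leq_trans (trunc_log_ltn _ p_gt1)) // leq_exp2l.
have : \sum_(1 <= k < m.*2.+1) (k <= trunc_log p m.*2) <= trunc_log p m.*2.
  elim: (m.*2) (trunc_log p m.*2) => [|n IHn] t; first by rewrite big_geq.
  rewrite big_nat_recr //=; case: (leqP n.+1 t) => [lt_nt|_]; last by rewrite addn0.
  rewrite addn1; apply: leq_trans lt_nt; rewrite ltnS.
  apply: (@leq_trans (\sum_(1 <= k < n.+1) 1)); first by apply: leq_sum => i _; case: (i <= t).
  by rewrite sum_nat_const_nat muln1; lia.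
lia.
Qed.

(** Serves to bound the product of the prime powers in a number without prime divisors above [x]: at
    most [x] indices contribute a factor. *)
Lemma leq_prod_indicator c x n : 0 < c ->
  \prod_(0 <= p < n) (if 0 < p <= x then c else 1) <= c ^ x.
Proof.
move=> c_gt0; suff : \prod_(0 <= p < n) (if 0 < p <= x then c else 1) <= c ^ minn n.-1 x.
  by move/leq_trans; apply; rewrite leq_pexp2l ?geq_minr.
elim: n => [|n IHn]; first by rewrite big_geq // min0n.
rewrite big_nat_recr //=; case: ifP => [/andP[n_gt0 le_nx]|_].
  rewrite (_ : minn n x = (minn n.-1 x).+1) ?expnSr ?leq_mul2r ?IHn ?orbT //; lia.
by rewrite muln1 (leq_trans IHn) // leq_pexp2l //; lia.
Qed.

(* Chebyshev: if every prime up to [2m] were at most [x], then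
   [2 ^ m <= 'C(2m, m) <= (2m) ^ x], which fails for [m = x ^ 2]. *)
Lemma exists_prime_between x : 6 < x ->
  exists2 p, prime p & x < p <= (x ^ 2).*2.
Proof.
move=> x_gt6; set m := x ^ 2; set C := 'C(m.*2, m).
have m_gt0 : 0 < m by rewrite expn_gt0; lia.
have C_gt0 : 0 < C by rewrite bin_gt0; lia.
(* The induction starts at [x = 7], where the claim reads [98 < 128]. *)
have small_x : m.*2 < 2 ^ x.
  rewrite /m; elim: x x_gt6 {m m_gt0 C C_gt0} => // x IHx.
  rewrite ltnS leq_eqVlt => /predU1P[<- //|lt_x]; have := IHx lt_x.
  by rewrite -!mulnn (expnS 2 x); nia.
pose P := has (fun p => prime p && (x < p)) (iota 0 m.*2.+1).
case: (boolP P) => [/hasP[p]|/hasPn no_p].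
  by rewrite mem_iota => le_p /andP[p_pr lt_xp]; exists p; lia.
have /(leq_trans (leq_expn2_central_bin m)) : C <= m.*2 ^ x.
  rewrite -[X in X <= _](partnT C_gt0).
  apply: leq_trans (@leq_prod_indicator m.*2 x C.+1 _); last by lia.
  rewrite /partn leq_prod // => p _.
  case: (posnP (logn p C)) => [->|]; first by case: ifP; lia.
  rewrite logn_gt0 mem_primes => /and3P[p_pr _ p_dv].
  have p_le : p <= m.*2.
    have : p %| m.*2`!.
      rewrite (dvdn_trans p_dv) //; have := @bin_fact m.*2 m.
      by rewrite -/C => <-; rewrite ?dvdn_mulr //; lia.
    elim: (m.*2) => [|n IHn]; first by rewrite fact0 dvdn1 => /eqP pE; rewrite pE in p_pr.
    by rewrite factS Euclid_dvdM // => /orP[/dvdn_leq|/IHn]; lia.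
  have px : p <= x by have := no_p p; rewrite mem_iota p_pr /= -leqNgt; lia.
  by rewrite prime_gt0 //= px leq_pfactor_central_bin.
rewrite leqNgt => /negP[].
apply: leq_trans (_ : (2 ^ x) ^ x <= _); first by rewrite ltn_exp2r //; lia.
by rewrite -expnM leq_pexp2l.
Qed.

(** * Universal hashing *)

(** The residue of [a * x] is scaled down to [[0, s)] rather than reduced modulo [s]; a bucket is
    thus an interval of residues. *)
Definition hash (p s a x : nat) : nat := (a * x %% p) * s %/ p.

Lemma hash_lt p s a x : 0 < p -> 0 < s -> hash p s a x < s.
Proof. by move=> p_gt0 s_gt0; rewrite ltn_divLR // mulnC ltn_pmul2l // ltn_pmod. Qed.

Definition collides (p s x y a : nat) : bool := hash p s a x == hash p s a y.

Lemma val_Fp_mul p (a : 'F_p) z : prime p -> (a * z%:R)%R = a * z %% p :> nat.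
Proof. by move=> p_pr; rewrite -{1}(natr_Zp a) -natrM val_Fp_nat. Qed.

(* A collision forces [a x - a y] to be, modulo [p], one of the at most
   [(p - 1) / s] residues [w] with [0 < w] and [w * s < p], and this residue
   determines [a]. *)
Lemma card_half_collisions p s x y : prime p -> 0 < s -> x < p -> y < p -> x != y ->
  #|[set a : 'F_p | collides p s x y a & a * y %% p < a * x %% p]| <= p.-1 %/ s.
Proof.
move=> p_pr s_gt0 lt_xp lt_yp neq_xy; set A := [set a | _ & _].
have p_gt0 := prime_gt0 p_pr.
pose w (a : 'F_p) := a * x %% p - a * y %% p.
have w_natr (a : 'F_p) : a \in A -> ((w a)%:R = a * (x%:R - y%:R) :> 'F_p)%R.
  rewrite inE => /andP[_ /ltnW le_w].
  by rewrite natrB // !Fp_nat_mod // !natrM natr_Zp mulrBr.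
have w_inj : {in A &, injective w}.
  move=> a b aA bA eq_w; have := w_natr a aA; rewrite eq_w w_natr //.
  move/esym/mulIf; apply; apply: contra neq_xy; rewrite subr_eq0 => /eqP.
  by move/(congr1 (@nat_of_ord _)); rewrite !val_Fp_nat // !modn_small // => ->.
have w_lt (a : 'F_p) : a \in A -> 0 < w a <= p.-1 %/ s.
  rewrite inE => /andP[/eqP eq_h lt_w]; rewrite subn_gt0 lt_w /=.
  rewrite leq_divRL //; move: eq_h; rewrite /hash /w.
  move: (a * x %% p) (a * y %% p) lt_w => u v lt_uv eq_h.
  have := divn_eq (u * s) p; have := divn_eq (v * s) p.
  have := ltn_pmod (u * s) p_gt0; rewrite eq_h mulnBl; lia.
rewrite -[X in _ <= X]card_ord.
pose g (a : 'F_p) : option 'I_(p.-1 %/ s) := insub (w a).-1.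
have gE a : a \in A -> exists2 i, g a = Some i & (w a).-1 = i :> nat.
  move=> /w_lt w_a; rewrite /g; case: insubP => [i _ <-|]; first by exists i.
  by case: (w a) w_a => [|n] //=; lia.
have -> : #|A| = #|[set g a | a in A]|.
  rewrite card_in_imset // => a b aA bA eq_g; apply: w_inj => //.
  have [i gi wi] := gE a aA; have [j gj wj] := gE b bA.
  move: eq_g; rewrite gi gj => -[eq_ij].
  by have := w_lt a aA; have := w_lt b bA; move: wi wj; rewrite eq_ij; lia.
have -> : #|'I_(p.-1 %/ s)| = #|[set Some i | i : 'I_(p.-1 %/ s)]|.
  by rewrite card_imset // => i j [].
apply/subset_leq_card/subsetP => _ /imsetP[a aA ->].
by have [i -> _] := gE a aA; apply: imset_f.
Qed.

(** Either residue may be the larger one, which gives two instances of the half bound; they cannot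
    be equal, as a nonzero [a] is invertible modulo [p]. *)
Lemma card_collisions p s x y : prime p -> 0 < s -> x < p -> y < p -> x != y ->
  #|[set a : 'F_p | collides p s x y a & a != 0%R]| * s <= 2 * p.-1.
Proof.
move=> p_pr s_gt0 lt_xp lt_yp neq_xy.
have p_gt0 := prime_gt0 p_pr.
apply: (@leq_trans ((p.-1 %/ s).*2 * s)); last first.
  by rewrite -mul2n -mulnA leq_mul2l leq_divM.
rewrite leq_mul2r -addnn; apply/orP; right.
have neq_yx : y != x by rewrite eq_sym.
apply: leq_trans _ (leq_add (card_half_collisions p s x y p_pr s_gt0 lt_xp lt_yp neq_xy)
   (card_half_collisions p s y x p_pr s_gt0 lt_yp lt_xp neq_yx)).
apply: leq_trans _ (leq_card_setU _ _); apply/subset_leq_card/subsetP => a.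
rewrite !inE => /andP[col a_neq0]; rewrite col /= /collides eq_sym -/(collides _ _ _ _ _) col.
rewrite /= -neq_ltn; apply: contra neq_xy => /eqP eq_xy.
have : (a * y%:R = a * x%:R :> 'F_p)%R.
  by apply: ord_inj; rewrite !val_Fp_mul.
move/(mulfI a_neq0)/(congr1 (@nat_of_ord _)); rewrite !val_Fp_nat // !modn_small //.
by move=> ->.
Qed.

Lemma leq_sum_const_seq (T : eqType) (S : seq T) (F : T -> nat) c :
  {in S, forall x, F x <= c} -> \sum_(x <- S) F x <= size S * c.
Proof.
elim: S => [|x S IHS] le_F; first by rewrite big_nil.
rewrite big_cons mulSn leq_add ?le_F ?mem_head // IHS // => y yS.
by rewrite le_F // inE yS orbT.
Qed.

Definition collisions (p s a : nat) (S : seq nat) : nat :=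
  \sum_(x <- S) \sum_(y <- S | x != y) collides p s x y a.

(** Averaging over the [p - 1] nonzero multipliers: each of the at most [size S ^ 2] ordered pairs
    collides for at most [2 * (p - 1) / s] of them. *)
Lemma exists_hash p s (S : seq nat) : prime p -> 0 < s -> all (ltn^~ p) S ->
  exists2 a, a < p & collisions p s a S * s <= 2 * size S ^ 2.
Proof.
move=> p_pr s_gt0 /allP lt_Sp.
have [p_gt0 p_gt1] := (prime_gt0 p_pr, prime_gt1 p_pr).
pose good (a : 'F_p) := (a != 0%R) && (collisions p s a S * s <= 2 * size S ^ 2).
case: (pickP good) => [a /andP[_ good_a]|bad].
  by exists a => //; rewrite -[X in _ < X](Fp_cast p_pr) ltn_ord.
have : \sum_(a : 'F_p | a != 0%R) (collisions p s a S * s) <= size S * (size S * (2 * p.-1)).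
  rewrite -big_distrl /= /collisions exchange_big big_distrl /=.
  apply: leq_sum_const_seq => x xS; rewrite exchange_big big_distrl /= big_mkcond.
  apply: leq_sum_const_seq => y yS; case: ifP => // neq_xy.
  apply: leq_trans _ (card_collisions p s x y p_pr s_gt0 (lt_Sp x xS) (lt_Sp y yS) neq_xy).
  rewrite leq_mul2r -sum1_card big_mkcond [X in _ <= X]big_mkcond leq_sum ?orbT // => a _.
  by rewrite inE; case: (collides _ _ _ _ _); case: (a != 0%R).
rewrite leqNgt => /negP[].
have : \sum_(a : 'F_p | a != 0%R) (2 * size S ^ 2).+1 <=
    \sum_(a : 'F_p | a != 0%R) collisions p s a S * s.
  apply: leq_sum => a a_neq0; have := bad a; rewrite /good a_neq0 /= => /negbT.
  by rewrite -ltnNge.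
rewrite sum_nat_const (eq_card (_ : _ =i predC1 (0%R : 'F_p))) // cardC1 card_Fp //.
by rewrite -mulnn; case: p p_gt1 {p_pr lt_Sp good bad p_gt0} => // p; nia.
Qed.

(** * Expressions and static dictionaries *)

(** Straight-line computations. Each trial of the search is one such expression, so that its cost is
    the length of the compiled code. *)
Inductive expr :=
  | Cst (n : nat)
  | Var (r : nat)
  | Bin (o : binop) (e1 e2 : expr)
  | Mem (e : expr).

Fixpoint eval (M : seq nat) (rg : nat -> nat) (e : expr) : nat :=
  match e with
  | Cst n => n
  | Var r => rg r
  | Bin o e1 e2 => eval_binop o (eval M rg e1) (eval M rg e2)
  | Mem e => nth 0 M (eval M rg e)
  end.

(** Reads outside the memory give 0 in [eval] but are faults of the machine; this predicate excludes
    them. *)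
Fixpoint in_range (M : seq nat) (rg : nat -> nat) (e : expr) : bool :=
  match e with
  | Cst _ | Var _ => true
  | Bin _ e1 e2 => in_range M rg e1 && in_range M rg e2
  | Mem e => in_range M rg e && (eval M rg e < size M)
  end.

Definition Emod (e1 e2 : expr) : expr := Bin Sub e1 (Bin Mul (Bin Div e1 e2) e2).

(** Subtraction being truncated, the sum of the two differences is the distance of the values. *)
Definition Eeq (e1 e2 : expr) : expr :=
  Bin Sub (Cst 1) (Bin Add (Bin Sub e1 e2) (Bin Sub e2 e1)).

Lemma eval_Emod M rg e1 e2 : eval M rg (Emod e1 e2) = eval M rg e1 %% eval M rg e2.
Proof. by rewrite /= {1}(divn_eq (eval M rg e1) (eval M rg e2)) addKn. Qed.

Lemma eval_Eeq M rg e1 e2 : eval M rg (Eeq e1 e2) = (eval M rg e1 == eval M rg e2).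
Proof. by rewrite /=; case: eqP; lia. Qed.

Definition Ehash (p s a x : expr) : expr := Bin Div (Bin Mul (Emod (Bin Mul a x) p) s) p.

Lemma eval_Ehash M rg p s a x : eval M rg (Ehash p s a x) =
  hash (eval M rg p) (eval M rg s) (eval M rg a) (eval M rg x).
Proof. by have := eval_Emod M rg (Bin Mul a x) p; rewrite /hash /= => ->. Qed.

Lemma in_range_Bin M rg o e1 e2 :
  in_range M rg e1 -> in_range M rg e2 -> in_range M rg (Bin o e1 e2).
Proof. by move=> /= -> ->. Qed.

Lemma in_range_Ehash M rg p s a x : in_range M rg p -> in_range M rg s ->
  in_range M rg a -> in_range M rg x -> in_range M rg (Ehash p s a x).
Proof. by move=> /= -> -> -> ->. Qed.

(* A dictionary occupies six header words, [p; a; s] for the first-level hash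
   function and three words of the client, followed by records of five words:
   multiplier, size and offset of the bucket with that number, then key and
   value of the slot with that number. *)
Definition Efield (c : nat) (i : expr) : expr :=
  Mem (Bin Add (Cst (6 + c)) (Bin Mul (Cst 5) i)).

Definition Ebucket (x : expr) : expr := Ehash (Mem (Cst 0)) (Mem (Cst 2)) (Mem (Cst 1)) x.

Definition Eslot (x : expr) : expr :=
  Bin Add (Efield 2 (Ebucket x))
    (Ehash (Mem (Cst 0)) (Efield 1 (Ebucket x)) (Efield 0 (Ebucket x)) x).

(** Multiplying by the outcome of the key comparison returns 0 for absent keys without a branch. *)
Definition Elookup (x : expr) : expr :=
  Bin Mul (Eeq (Efield 3 (Eslot x)) x) (Efield 4 (Eslot x)).

Definition dictionary (M : seq nat) (f : nat -> nat) : Prop :=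
  forall rg x, in_range M rg x ->
    in_range M rg (Elookup x) /\ eval M rg (Elookup x) = f (eval M rg x).

(** The squares count ordered pairs in a common bucket, the diagonal contributing [size S]. *)
Lemma sum_sqr_bucket (S : seq nat) (H : nat -> nat) s : uniq S ->
  \sum_(0 <= h < s) count (fun x => H x == h) S ^ 2 <=
  size S + \sum_(x <- S) \sum_(y <- S | x != y) (H x == H y).
Proof.
move=> uS.
under eq_bigr => h _ do
  rewrite -sum1_count big_mkcond /= -mulnn big_distrlr /=.
rewrite exchange_big -sum1_size -big_split /= leq_sum // => x _.
rewrite exchange_big /=.
apply: (@leq_trans (\sum_(y <- S) (H x == H y))).
  apply: leq_sum => y _; case: eqP => [_|neq]; last first.
    rewrite big1 // => h _; case: eqP => [Hx|//]; case: eqP => [Hy|//].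
    by case: neq; rewrite Hx.
  apply: (@leq_trans (\sum_(0 <= h < s) (h == H x))).
    by apply: leq_sum => h _; rewrite (eq_sym h); case: (H x == h); case: (H y == h).
  elim: s => [|s IHs]; first by rewrite big_geq.
  rewrite big_nat_recr //=; case: eqP => [eq_sx|_]; last by rewrite addn0.
  rewrite big_nat big1 // => h /andP[_ lt_hs]; apply/eqP; rewrite eqb0; lia.
rewrite (bigID (fun y => x == y)) /= leq_add2r.
apply: (@leq_trans (count_mem x S)); last by rewrite count_uniq_mem //; case: (_ \in _).
rewrite -sum1_count; under [X in _ <= X]eq_bigl => y do rewrite /= eq_sym.
by apply: leq_sum => y _; case: (H x == H y).
Qed.

Lemma collisions_eq0 p s a S : collisions p s a S = 0 ->
  {in S &, injective (hash p s a)}.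
Proof.
move/eqP; rewrite sum_nat_seq_eq0 => /allP no_col x y xS yS eq_h.
have := no_col x xS; rewrite sum_nat_seq_eq0 => /allP/(_ y yS).
by rewrite /collides eq_h eqxx; case: eqP.
Qed.

(** The two-level scheme: a first hash function into [n + 1] buckets, then for each bucket an
    injective one into a table of quadratic size. The value 0 stands for absence, so only the
    support of [f] is stored. *)
Lemma exists_dictionary (f : nat -> nat) (S : seq nat) p w u1 u2 u3 :
  (forall x, f x != 0 -> x \in S) -> all (ltn^~ p) S -> prime p -> uniq S ->
  p < w -> 9 * (size S).+1 ^ 2 < w -> (forall x, f x < w) ->
  all (ltn^~ w) [:: u1; u2; u3] ->
  exists M, [/\ dictionary M f, all (ltn^~ w) M, size M <= 40 * (size S).+1
    & [/\ 6 <= size M, nth 0 M 3 = u1, nth 0 M 4 = u2 & nth 0 M 5 = u3]].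
Proof.
move=> suppS lt_Sp p_pr uS lt_pw lt_nw lt_fw lt_uw; set n := size S.
have p_gt0 := prime_gt0 p_pr.
have [a0 lt_a0 col0] := exists_hash p n.+1 S p_pr isT lt_Sp.
pose H := hash p n.+1 a0.
pose bucket h := [seq x <- S | H x == h].
(* With this size, [exists_hash] bounds the number of collisions by a fraction below 1, so some
   multiplier has none. The successor keeps the size positive for empty buckets. *)
pose sz h := (2 * size (bucket h) ^ 2).+1.
have ex_mult h : exists a, (a < p) && (collisions p (sz h) a (bucket h) == 0).
  have [|a lt_a le_col] := exists_hash p (sz h) (bucket h) p_pr isT.
    by apply/allP => x; rewrite mem_filter => /andP[_ /(allP lt_Sp)].
  by exists a; rewrite lt_a /=; move: le_col; rewrite /sz; case: collisions => //; nia.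
pose mult h := ex_minn (ex_mult h).
have multP h : mult h < p /\ collisions p (sz h) (mult h) (bucket h) = 0.
  by rewrite /mult; case: ex_minnP => a /andP[lt_a /eqP].
pose off h := \sum_(0 <= j < h) sz j.
have offS h : off h.+1 = off h + sz h by rewrite /off big_nat_recr.
have off_mono : {homo off : h h' / h <= h'}.
  by apply: homo_leq (@leq_trans) _ => [//|h]; rewrite offS leq_addr.
pose pos x := off (H x) + hash p (sz (H x)) (mult (H x)) x.
have H_lt x : H x < n.+1 by apply: hash_lt.
have pos_lt_off x : pos x < off (H x).+1 by rewrite offS ltn_add2l hash_lt.
have pos_inj : {in S &, injective pos}.
  have lt_pos x y : H x < H y -> pos x < pos y.
    move=> lt_H; apply: leq_trans (leq_trans (pos_lt_off x) (off_mono _ _ lt_H)) _.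
    exact: leq_addr.
  move=> x y xS yS eq_pos; have eq_H : H x = H y.
    by case: (ltngtP (H x) (H y)) => // /lt_pos; rewrite eq_pos ltnn.
  move: eq_pos; rewrite /pos eq_H => /addnI.
  by apply: (collisions_eq0 _ _ _ _ (multP (H y)).2); rewrite mem_filter ?eq_H eqxx.
pose tot := off n.+1.
have pos_lt x : pos x < tot by apply: leq_trans (pos_lt_off x) (off_mono _ _ (H_lt x)).
(* There are at most [2n] first-level collisions, so the squares of the bucket sizes sum to at most
   [3n], and the table sizes to at most [2 * 3n + (n + 1)]. *)
have tot_le : tot <= 7 * n + 1.
  rewrite /tot /off; under eq_bigr do rewrite /sz size_filter -addn1.
  rewrite big_split /= sum_nat_const_nat -big_distrr /=.
  have := sum_sqr_bucket S H n.+1 uS.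
  have : \sum_(x <- S) \sum_(y <- S | x != y) (H x == H y) = collisions p n.+1 a0 S by [].
  by move=> ->; move: col0; rewrite -/n -mulnn; nia.
pose at_slot q := (fun x => pos x == q).
pose key q := nth 0 S (find (at_slot q) S).
pose value q := if has (at_slot q) S then f (key q) else 0.
(* An empty slot gets the default key 0, which may coincide with [x]; its value 0 keeps the product
   correct. *)
have lookup x : (key (pos x) == x) * value (pos x) = f x.
  rewrite /value; case: ifPn => [has_x|/hasPn no_x].
    have keyS : key (pos x) \in S by rewrite mem_nth // -has_find.
    have pos_key : pos (key (pos x)) = pos x by apply/eqP/(nth_find 0 has_x).
    case: eqP => [-> //|neq_key]; first by rewrite mul1n.
    rewrite mul0n; case: (f x =P 0) => [-> //|/eqP/suppS xS].
    by case: neq_key; apply: pos_inj.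
  rewrite muln0; case: (f x =P 0) => [-> //|/eqP/suppS /no_x].
  by rewrite /at_slot eqxx.
pose L := tot + n.+1.
(* Buckets and slots share one array of [L] records. In records past the last bucket the offset is
   capped, so that it still fits into a word. *)
pose field c i := nth 0 [:: mult i; sz i; off (minn i n.+1); key i; value i] c.
pose M := [:: p; a0; n.+1; u1; u2; u3] ++ mkseq (fun j => field (j %% 5) (j %/ 5)) (5 * L).
have szM : size M = 6 + 5 * L by rewrite size_cat size_mkseq.
have nthM c i : c < 5 -> i < L -> nth 0 M (6 + c + 5 * i) = field c i.
  move=> lt_c lt_i; rewrite /M nth_cat [size _]/= ltnNge -addnA leq_addr addnA /=.
  rewrite nth_mkseq; last by lia.
  have -> : 6 + c + 5 * i - 6 = i * 5 + c by lia.
  by rewrite modnMDl modn_small // divnMDl // divn_small ?addn0.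
have allM : all (ltn^~ w) M.
  rewrite all_cat /=; move: lt_uw => /= /and4P[-> -> -> _].
  have lt_n2 : (n.+1 ^ 2) < w by apply: leq_ltn_trans lt_nw; rewrite -/n; lia.
  rewrite lt_pw (ltn_trans lt_a0) // (leq_ltn_trans _ lt_n2) /=; last by rewrite -mulnn; nia.
  have le_sz i : size (bucket i) <= n by rewrite size_filter count_size.
  apply/(all_nthP 0) => j; rewrite size_mkseq => lt_j; rewrite nth_mkseq // /field.
  have i_lt : j %/ 5 < L by rewrite ltn_divLR // mulnC.
  move: (j %/ 5) i_lt (ltn_pmod j (isT : 0 < 5)) => i lt_i.
  have [lt_m _] := multP i.
  case: (j %% 5) => [|[|[|[|[|c]]]]] //= _.
  + exact: ltn_trans lt_m lt_pw.
  + apply: leq_ltn_trans lt_nw; rewrite /sz -/n; have := le_sz i.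
    by rewrite -!mulnn; nia.
  + apply: leq_ltn_trans (leq_trans (off_mono _ _ (geq_minr i n.+1)) tot_le) _.
    by apply: leq_ltn_trans lt_nw; rewrite -/n -mulnn; nia.
  + case: (boolP (has (at_slot i) S)) => has_i.
    have keyS : key i \in S by rewrite mem_nth // -has_find.
    exact: ltn_trans (allP lt_Sp _ keyS) lt_pw.
    by rewrite /key nth_default; [lia|rewrite leqNgt -has_find].
  + by rewrite /value; case: ifP => // _; lia.
have [M0 M1 M2] : [/\ nth 0 M 0 = p, nth 0 M 1 = a0 & nth 0 M 2 = n.+1] by [].
have [M3 M4 M5] : [/\ nth 0 M 3 = u1, nth 0 M 4 = u2 & nth 0 M 5 = u3] by [].
move: (M) szM nthM allM M0 M1 M2 M3 M4 M5 => {}M szM nthM allM M0 M1 M2 M3 M4 M5.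
exists M; split=> //; last 2 first.
- by rewrite szM /L -/n; lia.
- by rewrite szM; split.
- move=> rg x x_in.
  set X := eval M rg x.
  have eB : eval M rg (Ebucket x) = H X by rewrite eval_Ehash /= M0 M1 M2.
  have inB : in_range M rg (Ebucket x) by rewrite /= x_in szM.
  have inF c e : c < 5 -> in_range M rg e -> eval M rg e < L ->
      in_range M rg (Efield c e) /\ eval M rg (Efield c e) = field c (eval M rg e).
    move=> lt_c in_e lt_e; split; last exact: nthM.
    by rewrite /= in_e szM /=; lia.
  have HL : eval M rg (Ebucket x) < L by rewrite eB ltn_addl.
  have [in0 e0] := inF 0 _ isT inB HL.
  have [in1 e1] := inF 1 _ isT inB HL.
  have [in2 e2] := inF 2 _ isT inB HL.
  have inS : in_range M rg (Eslot x).
    by apply: in_range_Bin => //; apply: in_range_Ehash; rewrite //= szM.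
  have eS : eval M rg (Eslot x) = pos X.
    have -> : eval M rg (Eslot x) = eval M rg (Efield 2 (Ebucket x)) +
      eval M rg (Ehash (Mem (Cst 0)) (Efield 1 (Ebucket x)) (Efield 0 (Ebucket x)) x) by [].
    rewrite eval_Ehash [eval M rg (Mem (Cst 0))]/= M0 e0 e1 e2 eB /field /=.
    by rewrite (minn_idPl _) // ltnW.
  have SL : eval M rg (Eslot x) < L by rewrite eS ltn_addr.
  have [in3 e3] := inF 3 _ isT inS SL.
  have [in4 e4] := inF 4 _ isT inS SL.
  split.
    by do !apply: in_range_Bin.
  have -> : eval M rg (Elookup x) =
    eval M rg (Eeq (Efield 3 (Eslot x)) x) * eval M rg (Efield 4 (Eslot x)) by [].
  by rewrite eval_Eeq e3 e4 eS lookup.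
Qed.

(** * Compilation to the random access machine *)

(* The value of [e] ends up in register [t], the registers below [t] being
   preserved. *)
Fixpoint compile (e : expr) (t : nat) : program :=
  match e with
  | Cst n => [:: Const t n]
  | Var r => [:: Const t 0; Op Add t t r]
  | Bin o e1 e2 => compile e1 t ++ compile e2 t.+1 ++ [:: Op o t t t.+1]
  | Mem e => compile e t ++ [:: Fetch t t]
  end.

Fixpoint vars_below (t : nat) (e : expr) : bool :=
  match e with
  | Cst _ => true
  | Var r => r < t
  | Bin _ e1 e2 => vars_below t e1 && vars_below t e2
  | Mem e => vars_below t e
  end.

(* If variables and memory words are below [Y ^ d], where [2 <= Y], then all
   values occurring in the evaluation of [e] are below [Y ^ deg d e]. *)
Fixpoint deg (d : nat) (e : expr) : nat :=
  match e with
  | Cst n => n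
  | Var _ => d
  | Bin _ e1 e2 => (deg d e1 + deg d e2).+1
  | Mem e => maxn d (deg d e)
  end.

Lemma eval_lt_deg Y d M rg t e : 1 < Y -> all (ltn^~ (Y ^ d)) M ->
  (forall r, r < t -> rg r < Y ^ d) -> vars_below t e ->
  eval M rg e < Y ^ deg d e.
Proof.
move=> Y_gt1 lt_M lt_rg; have Y_gt0 : 0 < Y by apply: ltnW.
elim: e => [n|r|o e1 IH1 e2 IH2|e IH] /=.
- by move=> _; apply: ltn_expl.
- exact: lt_rg.
- move=> /andP[/IH1 lt1 /IH2 lt2].
  move: (eval M rg e1) (eval M rg e2) lt1 lt2 => u v lt_u lt_v.
  rewrite expnS expnD.
  have Y1 : 0 < Y ^ deg d e1 by rewrite expn_gt0 Y_gt0.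
  have Y2 : 0 < Y ^ deg d e2 by rewrite expn_gt0 Y_gt0.
  move: (Y ^ deg d e1) (Y ^ deg d e2) Y1 Y2 lt_u lt_v => y z y_gt0 z_gt0 lt_u lt_v.
  apply: leq_trans (_ : 2 * (y * z) <= _); last by rewrite leq_mul2r Y_gt1 orbT.
  have le_y : y <= y * z by rewrite leq_pmulr.
  have le_z : z <= y * z by rewrite leq_pmull.
  case: o => /=; try lia; first by have := ltn_mul lt_u lt_v; lia.
  by have := leq_div u v; lia.
move=> _; case: (ltnP (eval M rg e) (size M)) => [lt_M'|ge_M].
  by apply: leq_trans (all_nthP 0 lt_M _ lt_M') _; rewrite leq_pexp2l ?leq_maxl.
by rewrite nth_default // expn_gt0 Y_gt0.
Qed.

(** * Running code inside a larger program *)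

Definition code_at (P : program) (l : nat) (c : program) : Prop :=
  exists2 pre, size pre = l & exists post, P = pre ++ c ++ post.

Lemma code_at_catl P l c1 c2 : code_at P l (c1 ++ c2) -> code_at P l c1.
Proof. by case=> pre <- [post ->]; exists pre => //; exists (c2 ++ post); rewrite -catA. Qed.

Lemma code_at_catr P l c1 c2 : code_at P l (c1 ++ c2) -> code_at P (l + size c1) c2.
Proof.
case=> pre <- [post ->]; exists (pre ++ c1); first by rewrite size_cat.
by exists post; rewrite -!catA.
Qed.

Lemma onth_code_at P l c i : code_at P l c -> i < size c -> onth P (l + i) = onth c i.
Proof.
case=> pre <- [post ->] lt_i; rewrite !onthE !map_cat !nth_cat !size_map.
by rewrite ltnNge leq_addr /= addKn lt_i.
Qed.

Lemma run_add W P m n s : run W P (m + n) s = obind (run W P n) (run W P m s).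
Proof.
elim: m s => [|m IHm] s //=; case: (step W P s) => [s'|] //=; exact: IHm.
Qed.

(** [rg0] fixes the values of the variables, and [rg] has to agree with it only below [t0]:
    registers from [t0] up to [t] hold pending intermediate results. As the code has no jumps, it
    takes one step per instruction. *)
Lemma compile_correct Y d c P M rg0 t0 e : 1 < Y -> all (ltn^~ (Y ^ d)) M ->
  (forall r, r < t0 -> rg0 r < Y ^ d) -> vars_below t0 e -> in_range M rg0 e ->
  deg d e <= c -> forall t l rg, t0 <= t -> code_at P l (compile e t) ->
  (forall r, r < t0 -> rg r = rg0 r) ->
  exists rg', [/\ run (Y ^ c) P (size (compile e t)) (Config l rg M) =
                  Some (Config (l + size (compile e t)) rg' M),
    rg' t = eval M rg0 e & forall r, r < t -> rg' r = rg r].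
Proof.
move=> Y_gt1 lt_M lt_rg0.
have lt_eval e' : vars_below t0 e' -> deg d e' <= c -> eval M rg0 e' < Y ^ c.
  move=> vars_e' le_c; apply: leq_trans (eval_lt_deg _ _ _ _ _ _ Y_gt1 lt_M lt_rg0 vars_e') _.
  by rewrite leq_pexp2l // ltnW.
elim: e => [n|r|o e1 IH1 e2 IH2|e IH] vars_e in_e le_c t l rg le_t code_e eq_rg.
- have := onth_code_at _ _ _ 0 code_e isT; rewrite addn0 /= => eq0.
  exists (upd rg t n); split=> /=.
  + by rewrite /step /= eq0 /set_reg (lt_eval (Cst n)) //= addn1.
  + by rewrite /upd eqxx.
  + by move=> r lt_r; rewrite /upd ltn_eqF.
- have := onth_code_at _ _ _ 0 code_e isT; rewrite addn0 /= => eq0.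
  have := onth_code_at _ _ _ 1 code_e isT; rewrite addn1 /= => eq1.
  have lt_rt : r < t by apply: leq_trans le_t.
  have upd_t : upd rg t 0 t = 0 by rewrite /upd eqxx.
  have upd_r : upd rg t 0 r = rg0 r by rewrite /upd ltn_eqF // eq_rg.
  exists (upd (upd rg t 0) t (rg0 r)); split=> /=.
  + rewrite /step /= eq0 /set_reg expn_gt0 (ltnW Y_gt1) /= eq1 /= upd_t upd_r.
    by rewrite add0n (lt_eval (Var r)) //= addn2.
  + by rewrite /upd eqxx.
  + by move=> r' lt_r; rewrite /upd !ltn_eqF.
- move: vars_e in_e => /= /andP[vars1 vars2] /andP[in1 in2].
  have [le1 le2] : deg d e1 <= c /\ deg d e2 <= c by move: le_c => /=; lia.
  have [rg1 [run1 val1 eq1]] := IH1 vars1 in1 le1 t l rg le_t (code_at_catl _ _ _ _ code_e) eq_rg.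
  have code2 : code_at P (l + size (compile e1 t)) (compile e2 t.+1 ++ [:: Op o t t t.+1]).
    exact: code_at_catr code_e.
  have eq_rg1 r : r < t0 -> rg1 r = rg0 r.
    by move=> lt_r; rewrite eq1 ?eq_rg // (leq_trans lt_r).
  have [rg2 [run2 val2 eq2]] :=
    IH2 vars2 in2 le2 t.+1 _ rg1 (leqW le_t) (code_at_catl _ _ _ _ code2) eq_rg1.
  have := onth_code_at _ _ _ 0 (code_at_catr _ _ _ _ code2) isT; rewrite addn0 /= => eq3.
  exists (upd rg2 t (eval M rg0 (Bin o e1 e2))); split.
  + rewrite [compile _ _]/= !size_cat run_add run1 [obind _ _]/= run_add run2 /=.
    rewrite /step /= eq3 /set_reg.
    rewrite eq2 // val1 val2 (lt_eval (Bin o e1 e2)) //= ?vars1 //.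
    by rewrite !addnA addn1.
  + by rewrite /upd eqxx.
  + by move=> r lt_r; rewrite /upd ltn_eqF // eq2 ?eq1 // ltnW.
move: in_e => /= /andP[in_e in_M].
have [|rg1 [run1 val1 eq1]] := IH vars_e in_e _ t l rg le_t (code_at_catl _ _ _ _ code_e) eq_rg.
  by move: le_c => /=; lia.
have := onth_code_at _ _ _ 0 (code_at_catr _ _ _ _ code_e) isT; rewrite addn0 /= => eq2.
exists (upd rg1 t (eval M rg0 (Mem e))); split.
- rewrite [compile _ _]/= size_cat run_add run1 /= /step /= eq2 val1 in_M /set_reg.
  by rewrite (lt_eval (Mem e)) //= addnA addn1.
- by rewrite /upd eqxx.
- by move=> r lt_r; rewrite /upd ltn_eqF // eq1.
Qed.

(* The trial [e] is run with register 2 counting down from memory word 5 to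
   [0], until it succeeds. *)
Definition search (e : expr) : program :=
  let l := 2 + size (compile e 3) in
  [:: Const 2 5; Fetch 2 2] ++ compile e 3 ++
  [:: JumpZero 3 (l + 3); Const 0 1; Halt;
      JumpZero 2 (l + 7); Const 3 1; Op Sub 2 2 3; Jump 2; Const 0 0; Halt].

Definition trial_env (a b n : nat) : nat -> nat := nth 0 [:: a; b; n].

(** The counter takes at most [nth 0 M 5 + 1] values, each costing at most [size (compile e 3) + 5]
    steps; replacing 5 by 7 absorbs the two set-up steps. *)
Lemma search_correct Y d c M e a b : 1 < Y -> all (ltn^~ (Y ^ d)) M ->
  a < Y ^ d -> b < Y ^ d -> 5 < Y ^ c -> d <= c -> 5 < size M ->
  vars_below 3 e -> deg d e <= c -> (forall rg, in_range M rg e) ->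
  exists2 t, t <= ((nth 0 M 5).+1 * (size (compile e 3) + 7)) &
  answers_in (Y ^ c) (search e) M a b
    (exists2 n, n <= nth 0 M 5 & eval M (trial_env a b n) e <> 0) t.
Proof.
move=> Y_gt1 lt_M lt_a lt_b lt_c le_dc lt_5 vars_e deg_e in_e.
set W := Y ^ c; set B := size (compile e 3).
have [l def_l] : exists l, l = 2 + B by eexists.
have [P def_P] : exists P, P = search e by eexists.
have lt_n : nth 0 M 5 < Y ^ d := all_nthP 0 lt_M _ lt_5.
have W_gt1 : 1 < W by apply: leq_trans lt_c.
have lt_dW x : x < Y ^ d -> x < W.
  by move/leq_trans; apply; rewrite leq_pexp2l // ltnW.
have code_0 : code_at P 0 [:: Const 2 5; Fetch 2 2].
  by exists [::] => //; rewrite def_P; eexists.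
have code_e : code_at P 2 (compile e 3).
  by rewrite def_P; exists [:: Const 2 5; Fetch 2 2] => //; eexists; reflexivity.
have code_l : code_at P l [:: JumpZero 3 (l + 3); Const 0 1; Halt;
      JumpZero 2 (l + 7); Const 3 1; Op Sub 2 2 3; Jump 2; Const 0 0; Halt].
  exists ([:: Const 2 5; Fetch 2 2] ++ compile e 3); first by rewrite size_cat def_l.
  by exists [::]; rewrite def_P cats0 -catA def_l.
have at_0 : onth P 0 = Some (Const 2 5) by apply: (onth_code_at _ _ _ 0 code_0).
have at_1 : onth P 1 = Some (Fetch 2 2) by apply: (onth_code_at _ _ _ 1 code_0).
have at_l i : i < 9 -> onth P (l + i) = onth [:: JumpZero 3 (l + 3); Const 0 1; Halt;
      JumpZero 2 (l + 7); Const 3 1; Op Sub 2 2 3; Jump 2; Const 0 0; Halt] i.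
  exact: onth_code_at _ _ _ i code_l.
have step_l i rg ins : i < 9 -> onth P (l + i) = Some ins ->
    step W P (Config (l + i) rg M) =
    match ins with
    | Const r n => set_reg W (Config (l + i) rg M) r n
    | Op o r s1 s2 => set_reg W (Config (l + i) rg M) r (eval_binop o (rg s1) (rg s2))
    | Jump k => Some (Config k rg M)
    | JumpZero r k => Some (Config (if rg r == 0 then k else (l + i).+1) rg M)
    | _ => step W P (Config (l + i) rg M)
    end.
  by move=> _ eq_i; rewrite /step /= eq_i; case: ins {eq_i}.
rewrite -def_P.
have run_fail0 rg : rg 3 = 0 -> rg 2 = 0 ->
    run W P 3 (Config l rg M) = Some (Config (l + 8) (upd rg 0 0) M).
  move=> rg3 rg2; rewrite -{1}[l]addn0 /run (step_l 0 _ _ isT (at_l 0 isT)) rg3 /=.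
  rewrite (step_l 3 _ _ isT (at_l 3 isT)) rg2 /=.
  by rewrite (step_l 7 _ _ isT (at_l 7 isT)) /set_reg (ltnW W_gt1) /= -addnS.
have run_failS rg n : rg 3 = 0 -> rg 2 = n.+1 -> n < W ->
    run W P 5 (Config l rg M) = Some (Config 2 (upd (upd rg 3 1) 2 n) M).
  move=> rg3 rg2 lt_nW; rewrite -{1}[l]addn0 /run (step_l 0 _ _ isT (at_l 0 isT)) rg3 /=.
  rewrite (step_l 3 _ _ isT (at_l 3 isT)) rg2 /= -addnS.
  rewrite (step_l 4 _ _ isT (at_l 4 isT)) /set_reg W_gt1 /= -addnS.
  rewrite (step_l 5 _ _ isT (at_l 5 isT)) /set_reg {1 2}/upd /= rg2 subn1 lt_nW /=.
  by rewrite -addnS (step_l 6 _ _ isT (at_l 6 isT)) /upd /= rg2 subn1.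
have run_succeed rg : rg 3 <> 0 ->
    run W P 2 (Config l rg M) = Some (Config (l + 2) (upd rg 0 1) M).
  move/eqP/negPf => rg3; rewrite -{1}[l]addn0 /run (step_l 0 _ _ isT (at_l 0 isT)) rg3 /=.
  by rewrite -addnS (step_l 1 _ _ isT (at_l 1 isT)) /set_reg W_gt1 /= -addnS.
have loop n : n < Y ^ d -> forall rg, rg 0 = a -> rg 1 = b -> rg 2 = n ->
    exists t s, [/\ t <= n.+1 * (B + 5), run W P t (Config 2 rg M) = Some s,
      halted P s, mem s = M &
      reg s 0 <> 0 <-> exists2 m, m <= n & eval M (trial_env a b m) e <> 0].
  elim: n => [|n IHn] lt_nd rg rg_a rg_b rg_n;
  have [||rg1 [run1 val1 eq1]] := compile_correct Y d c P M (trial_env a b (rg 2)) 3 e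
      Y_gt1 lt_M _ vars_e (in_e _) deg_e 3 2 rg (leqnn 3) code_e;
  try (by rewrite ?rg_n; case=> [|[|[|r]]]);
  rewrite -/B -def_l rg_n in run1 val1;
  case: (rg1 3 =P 0) => [eq0|neq0].
  - exists (B + 3), (Config (l + 8) (upd rg1 0 0) M); split=> //; first by lia.
    + by rewrite run_add run1 /obind /oapp run_fail0 ?(eq1 2) ?rg_n.
    + exact: at_l.
    split=> [/(_ erefl) //|[m]]; rewrite leqn0 => /eqP-> neq0.
    by case: neq0; rewrite -val1.
  - exists (B + 2), (Config (l + 2) (upd rg1 0 1) M); split=> //; first by lia.
    + by rewrite run_add run1 /obind /oapp run_succeed.
    + exact: at_l.
    by split=> // _; exists 0; rewrite // -val1.
  - have [||||t [s [le_t run_t halt_s mem_s ans_s]]] :=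
      IHn _ (upd (upd rg1 3 1) 2 n); rewrite // 1?ltnW // /upd /= ?eq1 //.
    exists (B + (5 + t)), s; split=> //; first by lia.
      by rewrite run_add run1 /obind /oapp run_add (run_failS _ n) ?(eq1 2) ?rg_n // lt_dW // ltnW.
    rewrite ans_s; split=> -[m le_m neq0]; first by exists m; rewrite // leqW.
    exists m => //; move: le_m; rewrite leq_eqVlt => /predU1P[eq_m|//].
    by case: neq0; rewrite eq_m -val1.
  - exists (B + 2), (Config (l + 2) (upd rg1 0 1) M); split=> //; first by lia.
    + by rewrite run_add run1 /obind /oapp run_succeed.
    + exact: at_l.
    by split=> // _; exists n.+1; rewrite // -val1.
have [|||t [s [le_t run_t halt_s mem_s ans_s]]] :=
  loop _ lt_n (upd (upd (reg (start M a b)) 2 5) 2 (nth 0 M 5)); rewrite //.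
exists (2 + t); first by lia.
exists s; split=> //; rewrite run_add.
suff -> : run W P 2 (start M a b) =
    Some (Config 2 (upd (upd (reg (start M a b)) 2 5) 2 (nth 0 M 5)) M) by [].
have step_0 : step W P (start M a b) = Some (Config 1 (upd (reg (start M a b)) 2 5) M).
  by rewrite /step at_0 /set_reg lt_c.
have step_1 rg : rg 2 = 5 -> step W P (Config 1 rg M) = Some (Config 2 (upd rg 2 (nth 0 M 5)) M).
  by rewrite /step at_1 /set_reg [reg _]/= => ->; rewrite lt_5 lt_dW.
by rewrite /run step_0 /obind /oapp step_1.
Qed.

(** * The stored tables and the search *)

(** Occurrences of distinct values are disjoint. This bounds the number of heavy vertices, and also
    the number of pairs with a large product of degrees. *)
Lemma heavy_hitters (T : eqType) (s : seq T) c :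
  size [seq x <- undup s | c <= count_mem x s] * c <= size s.
Proof.
set h := [seq x <- _ | _].
apply: (@leq_trans (\sum_(x <- h) count_mem x s)).
  rewrite -sum1_size big_distrl /= big_seq [X in _ <= X]big_seq leq_sum // => x.
  by rewrite mul1n mem_filter => /andP[].
have uh : uniq h by rewrite filter_uniq ?undup_uniq.
under eq_bigr do rewrite -sum1_count big_mkcond.
rewrite exchange_big /= -sum1_size leq_sum // => y _.
have : \sum_(x <- h) (if y == x then 1 else 0) = count_mem y h.
  by rewrite -big_mkcond -sum1_count; apply: eq_bigl => x; rewrite /= eq_sym.
by move=> /= ->; rewrite count_uniq_mem //; case: (_ \in _).
Qed.

Section Tables.

Variables (G : nat -> seq (nat * nat)) (d B R : nat).
Hypothesis G_uniq : forall i, uniq (G i).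

Definition outs i u := [seq e.2 | e <- G i & e.1 == u].
Definition ins i v := [seq e.1 | e <- G i & e.2 == v].

Lemma mem_outs i u v : (v \in outs i u) = ((u, v) \in G i).
Proof.
apply/mapP/idP => [[[u' v']]|uv].
  by rewrite mem_filter /= => /andP[/eqP-> ?] ->.
by exists (u, v); rewrite // mem_filter /= eqxx.
Qed.

Lemma mem_ins i u v : (u \in ins i v) = ((u, v) \in G i).
Proof.
apply/mapP/idP => [[[u' v']]|uv].
  by rewrite mem_filter /= => /andP[/eqP-> ?] ->.
by exists (u, v); rewrite // mem_filter /= eqxx.
Qed.

Lemma outs_uniq i u : uniq (outs i u).
Proof.
rewrite map_inj_in_uniq ?filter_uniq // => -[x y] [x' y'].
by rewrite !mem_filter /= => /andP[/eqP-> _] /andP[/eqP-> _] ->.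
Qed.

Lemma ins_uniq i v : uniq (ins i v).
Proof.
rewrite map_inj_in_uniq ?filter_uniq // => -[x y] [x' y'].
by rewrite !mem_filter /= => /andP[/eqP-> _] /andP[/eqP-> _] ->.
Qed.

Lemma size_outs i u : size (outs i u) = count_mem u [seq e.1 | e <- G i].
Proof. by rewrite size_map size_filter count_map; apply: eq_count. Qed.

Lemma size_ins i v : size (ins i v) = count_mem v [seq e.2 | e <- G i].
Proof. by rewrite size_map size_filter count_map; apply: eq_count. Qed.

(** * Walks through consecutive relations *)

Fixpoint walk i l u v : bool :=
  if l is l'.+1 then has (fun w => walk i.+1 l' w v) (outs i u) else u == v.

Lemma walkD i l m u v :
  walk i (l + m) u v <-> exists2 w, walk i l u w & walk (i + l) m w v.
Proof.
elim: l i u => [|l IHl] i u.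
  by rewrite addn0; split=> [?|[w /eqP-> //]]; exists u => /=.
rewrite addSn /= addnS -addSn; split.
  case/hasP => x ux /IHl[w xw wv]; exists w => //.
  by apply/hasP; exists x.
case=> w /hasP[x ux xw] wv; apply/hasP; exists x => //.
by apply/IHl; exists w.
Qed.

Lemma walk1 i u v : walk i 1 u v = (v \in outs i u).
Proof.
rewrite /=; apply/hasP/idP => [[w uw /eqP <-] //|uv]; by exists v => /=.
Qed.

Lemma walk1_ins i u v : walk i 1 u v = (u \in ins i v).
Proof. by rewrite walk1 mem_outs mem_ins. Qed.

Lemma walkSr i l u v : walk i l.+1 u v <-> exists2 w, walk i l u w & w \in ins (i + l) v.
Proof.
by rewrite -addn1 walkD; split=> -[w uw wv]; exists w; rewrite ?walk1_ins // -walk1_ins.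
Qed.

Definition heavy i :=
  [seq x <- undup [seq e.1 | e <- G i] | d < count_mem x [seq e.1 | e <- G i]].

Lemma mem_heavy i x : (x \in heavy i) = (d < size (outs i x)).
Proof.
rewrite mem_filter mem_undup size_outs; case: ltnP => //= lt_d.
by rewrite -has_pred1 has_count (leq_trans _ lt_d).
Qed.

Lemma size_heavy i : size (heavy i) * d.+1 <= size (G i).
Proof. by rewrite (leq_trans (heavy_hitters _ _ _)) // size_map. Qed.

Definition light_mid i u v :=
  has (fun w => (v \in outs i.+1 w) && (size (outs i.+1 w) <= d)) (outs i u).

(** For [l = 2] the alternatives are the 2-path queries asked by [trial 0]: those with a light
    middle vertex, and those with a heavy vertex at one end, which are the halves of a 4-path with a
    heavy middle. Otherwise the product of the degrees decides. *)
Definition is_stored l i u v : bool :=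
  if l == 2 then [|| light_mid i u v, d < size (outs i u) | d < size (outs i.+2 v)]
  else B <= size (outs i u) * size (ins (i + l).-1 v).

(* In the tables, the vertex [u] is represented by [u.+1], and [0] stands for
   the absence of a vertex. *)
Definition answer_tab l i u v : nat :=
  match u, v with
  | u'.+1, v'.+1 => walk i l u' v' && is_stored l i u' v'
  | _, _ => 0
  end.

Definition out_tab i u j : nat :=
  if u is u'.+1 then nth 0 (map succn (outs i u')) j else 0.

Definition in_tab i v j : nat :=
  if v is v'.+1 then nth 0 (map succn (ins i v')) j else 0.

(** The index [z] gives this table the shape of the others; having nonzero entries only at [z = 0]
    keeps the support small. *)
Definition degree_tab i u z : nat :=
  match u, z with u'.+1, 0 => size (outs i u') | _, _ => 0 end.

Definition heavy_tab i m z : nat :=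
  if z is 0 then nth 0 (map succn (heavy i)) m else 0.

Definition table t i u v : nat :=
  match t with
  | 0 => out_tab i u v
  | 1 => in_tab i u v
  | 2 => degree_tab i u v
  | 3 => heavy_tab i u v
  | l.+4 => answer_tab l i u v
  end.

(* If [D = 0] then [n %% D = n]; this is harmless, as a trial succeeds only if
   the endpoints are connected, whatever [n] is. *)
Fixpoint trial l i a b n : nat :=
  answer_tab (l + 4) i a b +
  if l is l'.+1 then
    if degree_tab i a 0 <= R
    then trial l' i.+1 (out_tab i a (n %% R)) b (n %/ R)
    else trial l' i a (in_tab (i + l + 3) b (n %% R)) (n %/ R)
  else
    let D := degree_tab i a 0 in
    let h := heavy_tab i.+2 n 0 in
    answer_tab 2 i.+1 (out_tab i a (n %% D)) (in_tab (i + 3) b (n %/ D)) +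
    answer_tab 2 i a h * answer_tab 2 i.+2 h b.

Lemma trial0E i a b n : trial 0 i a b n =
  answer_tab 4 i a b +
  (answer_tab 2 i.+1 (out_tab i a (n %% degree_tab i a 0))
     (in_tab (i + 3) b (n %/ degree_tab i a 0)) +
   answer_tab 2 i a (heavy_tab i.+2 n 0) * answer_tab 2 i.+2 (heavy_tab i.+2 n 0) b).
Proof. by []. Qed.

Lemma trialS l i a b n : trial l.+1 i a b n =
  answer_tab (l.+1 + 4) i a b +
  if degree_tab i a 0 <= R then trial l i.+1 (out_tab i a (n %% R)) b (n %/ R)
  else trial l i a (in_tab (i + l.+1 + 3) b (n %% R)) (n %/ R).
Proof. by []. Qed.

(** * Soundness of a trial *)

Lemma nth_map_succn (s : seq nat) j x : nth 0 (map succn s) j = x.+1 -> x \in s.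
Proof.
case: (ltnP j (size s)) => [lt_j|ge_j]; last by rewrite nth_default // size_map.
by rewrite (nth_map 0) // => -[<-]; rewrite mem_nth.
Qed.

Lemma answer_tab_sound l i a b : answer_tab l i a b != 0 ->
  exists a' b', [/\ a = a'.+1, b = b'.+1 & walk i l a' b'].
Proof.
case: a b => [|a] [|b] //=; rewrite eqb0 negbK => /andP[? _].
by exists a, b.
Qed.

Lemma out_tabP i a j w : out_tab i a j = w.+1 ->
  exists2 a', a = a'.+1 & w \in outs i a'.
Proof. by case: a => [|a] //= /nth_map_succn; exists a. Qed.

Lemma in_tabP i b j w : in_tab i b j = w.+1 ->
  exists2 b', b = b'.+1 & w \in ins i b'.
Proof. by case: b => [|b] //= /nth_map_succn; exists b. Qed.

(** Sums act as disjunctions and products as conjunctions. An index beyond a list of neighbours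
    yields 0, for which every answer is 0, so a nonzero result comes from genuine edges. *)
Lemma trial_sound l i a b n : trial l i a b n != 0 ->
  exists a' b', [/\ a = a'.+1, b = b'.+1 & walk i (l + 4) a' b'].
Proof.
elim: l i a b n => [|l IHl] i a b n; rewrite [trial _ _ _ _ _]/= addn_eq0 negb_and;
  case/orP => [/answer_tab_sound //|].
  rewrite addn_eq0 negb_and muln_eq0 negb_or => /orP[|/andP[]].
    case/answer_tab_sound => x [y [/out_tabP[a' -> a'x] /in_tabP[b' -> yb'] xy]].
    exists a', b'; split=> //; apply/(walkSr i 3); exists y => //.
    by apply/(walkD i 1 2); exists x; rewrite ?walk1 // addn1.
  case/answer_tab_sound => a' [x [-> eq_x a'x]].
  case/answer_tab_sound => x' [b' [eq_x' -> x'b']].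
  exists a', b'; split=> //; apply/(walkD i 2 2); exists x => //.
  by move: eq_x; rewrite eq_x' addn2 => -[<-].
case: ifP => _ /IHl[x [y []]].
  case/out_tabP => a' -> a'x -> xy; exists a', y; split=> //.
  by rewrite addSn /=; apply/hasP; exists x.
move=> -> /in_tabP[b' -> yb'] xy; exists x, b'; split=> //.
by rewrite addSn; apply/walkSr; exists y => //; move: yb'; congr (_ \in ins _ _); lia.
Qed.

(** * Completeness of the trials *)

Hypotheses (R_gt0 : 0 < R) (B_gt0 : 0 < B) (leB : B <= R.+1 ^ 2)
  (heavy_ltB : forall i, size (heavy i) < B).

Lemma mem_nth_succn (s : seq nat) x : x \in s ->
  exists2 j, j < size s & nth 0 (map succn s) j = x.+1.
Proof.
move=> xs; exists (index x s); first by rewrite index_mem.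
by rewrite (nth_map 0) ?index_mem // nth_index.
Qed.

Lemma trial_stored l i a b : walk i (l + 4) a b ->
  B <= size (outs i a) * size (ins (i + (l + 4)).-1 b) -> trial l i a.+1 b.+1 0 != 0.
Proof.
move=> ab le_B; have : answer_tab (l + 4) i a.+1 b.+1 != 0.
  by rewrite /= /is_stored ab le_B addnC.
by case: l {ab le_B} => [|l] ans; rewrite ?trial0E ?trialS addn_eq0 negb_and ans.
Qed.

(** For [l > 0], either the answer is stored or one endpoint has at most [R] neighbours; the lowest
    digit of [n] in base [R] then picks the neighbour on a given walk, and the quotient is passed on
    to the shorter walk. *)
Lemma trial_complete l i a b : walk i (l + 4) a b ->
  exists2 n, n < R ^ l * B & trial l i a.+1 b.+1 n != 0.
Proof.
elim: l i a b => [|l IHl] i a b ab.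
- have [le_B|lt_B] := leqP B (size (outs i a) * size (ins (i + 4).-1 b)).
    by exists 0; [rewrite mul1n|exact: trial_stored].
  have [y ay yb] := (walkSr i 3 a b).1 ab.
  have [z az zy] := (walkSr i 2 a y).1 ay.
  have [x ax xz] := (walkSr i 1 a z).1 az.
  rewrite walk1 in ax.
  have zb : walk i.+2 2 z b.
    by apply/(walkD i.+2 1 1); exists y; rewrite walk1_ins -(addn2 i) // -addnA.
  case: (leqP (size (outs i.+2 z)) d) => light_z.
    have [j1 lt_j1 out_j1] := mem_nth_succn _ _ ax.
    have [j2 lt_j2 in_j2] := mem_nth_succn _ _ yb.
    (* The product of the two degrees is below [B], hence so is this number. *)
    exists (j2 * size (outs i a) + j1).
      by move: lt_B lt_j2; rewrite expn0 mul1n (_ : (i + 4).-1 = i + 3); [nia|lia].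
    rewrite trial0E [degree_tab _ _ _]/= addn_eq0 negb_and; apply/orP; right.
    have outs_gt0 : 0 < size (outs i a) by apply: leq_trans lt_j1.
    rewrite modnMDl modn_small // divnMDl // divn_small // addn0.
    rewrite [out_tab _ _ _]/= out_j1 [in_tab _ _ _]/= in_j2.
    rewrite addn_eq0 negb_and; apply/orP; left.
    have xy : walk i.+1 2 x y.
      by apply/(walkD i.+1 1 1); exists z; rewrite walk1_ins -(addn1 i) // -addnA.
    rewrite /answer_tab xy /= /is_stored /= eqb0 negbK; apply/orP; left.
    apply/hasP; exists z; first by rewrite -walk1 walk1_ins -(addn1 i).
    by rewrite light_z andbT -walk1 walk1_ins -(addn2 i).
  have z_heavy : z \in heavy i.+2 by rewrite mem_heavy.
  have [m lt_m heavy_m] := mem_nth_succn _ _ z_heavy.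
  (* The same counter, read as an index, enumerates the heavy vertices, of which there are fewer
     than [B]. *)
  exists m; first by rewrite mul1n (ltn_trans lt_m).
  rewrite trial0E [heavy_tab _ _ _]/= heavy_m addn_eq0 negb_and; apply/orP; right.
  rewrite addn_eq0 negb_and muln_eq0 negb_or; apply/orP; right.
  by rewrite /answer_tab az zb /is_stored /= light_z !orbT.
have [le_B|lt_B] := leqP B (size (outs i a) * size (ins (i + (l.+1 + 4)).-1 b)).
  by exists 0; [rewrite muln_gt0 expn_gt0 R_gt0|exact: trial_stored].
case: (leqP (size (outs i a)) R) => deg_a.
  have /hasP[x ax xb] : walk i (l + 4).+1 a b := ab.
  have [j lt_j out_j] := mem_nth_succn _ _ ax.
  have [n lt_n tr_n] := IHl i.+1 x b xb.
  have lt_jR : j < R by apply: leq_trans deg_a.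
  exists (n * R + j); first by rewrite expnS; nia.
  rewrite trialS [degree_tab _ _ _]/= deg_a addn_eq0 negb_and; apply/orP; right.
  by rewrite modnMDl modn_small // divnMDl // divn_small // addn0 [out_tab _ _ _]/= out_j.
(* Two degrees above [R] would have a product of at least [R.+1 ^ 2], hence of at least [B]. *)
have deg_b : size (ins (i + (l.+1 + 4)).-1 b) <= R.
  rewrite leqNgt; apply/negP => lt_Rb.
  by have := leq_mul deg_a lt_Rb; move: leB; rewrite -mulnn; lia.
have [y ay yb] := (walkSr i (l + 4) a b).1 ab.
have [j lt_j in_j] := mem_nth_succn _ _ yb.
have [n lt_n tr_n] := IHl i a y ay.
have eq_i : i + (l + 4) = (i + (l.+1 + 4)).-1 by lia.
have lt_jR : j < R by apply: leq_trans deg_b; rewrite -eq_i.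
exists (n * R + j); first by rewrite expnS; nia.
rewrite trialS [degree_tab _ _ _]/= leqNgt deg_a addn_eq0 negb_and; apply/orP; right.
rewrite modnMDl modn_small // divnMDl // divn_small // addn0 (_ : i + l.+1 + 3 = i + (l + 4)).
  by rewrite [in_tab _ _ _]/= in_j.
by lia.
Qed.

End Tables.

(** * Size of the tables *)

Lemma size_flatten_map_le (I T : eqType) (F : I -> seq T) (r : seq I) c :
  {in r, forall i, size (F i) <= c} -> size (flatten (map F r)) <= size r * c.
Proof.
elim: r => [|i r IHr] // le_F /=; rewrite size_cat mulSn leq_add ?le_F ?mem_head //.
by rewrite IHr // => j jr; rewrite le_F // inE jr orbT.
Qed.

Section Support.

Variables (G : nat -> seq (nat * nat)) (d B k N U Z : nat).
Hypotheses (G_uniq : forall i, uniq (G i)) (G_k : forall i, k <= i -> G i = [::])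
  (G_N : forall i, size (G i) <= N) (B_gt0 : 0 < B)
  (G_U : forall i e, e \in G i -> e.1 < U /\ e.2 < U).

Lemma outs_lt i u v : v \in outs G i u -> [/\ i < k, u < U & v < U].
Proof.
rewrite mem_outs => uv; have [/= lt_u lt_v] := G_U _ _ uv; split=> //.
by rewrite ltnNge; apply/negP => /G_k Gi; rewrite Gi in uv.
Qed.

Lemma ins_lt i u v : u \in ins G i v -> [/\ i < k, u < U & v < U].
Proof. by rewrite mem_ins -mem_outs => /outs_lt. Qed.

Lemma size_outs_le i u : size (outs G i u) <= N.
Proof. by rewrite size_outs (leq_trans (count_size _ _)) ?size_map. Qed.

Lemma size_ins_le i u : size (ins G i u) <= N.
Proof. by rewrite size_ins (leq_trans (count_size _ _)) ?size_map. Qed.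

Lemma outs_gt0 i u : 0 < size (outs G i u) -> i < k /\ u < U.
Proof.
by case E : (outs G i u) => [|v s] // _; have [] : [/\ i < k, u < U & v < U]
  by apply: outs_lt; rewrite E mem_head.
Qed.

Lemma ins_gt0 i u : 0 < size (ins G i u) -> i < k /\ u < U.
Proof.
by case E : (ins G i u) => [|v s] // _; have [] : [/\ i < k, v < U & u < U]
  by apply: ins_lt; rewrite E mem_head.
Qed.

Lemma heavy_lt i x : x \in heavy G d i -> i < k /\ x < U.
Proof. by rewrite mem_heavy => lt_d; apply: outs_gt0; apply: leq_ltn_trans lt_d. Qed.

Lemma size_heavy_le i : size (heavy G d i) <= N.
Proof. by have := size_heavy G d i; have := G_N i; nia. Qed.

Lemma nth_succn_ne0 (s : seq nat) j : nth 0 (map succn s) j != 0 ->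
  j < size s /\ nth 0 s j \in s.
Proof.
case: (ltnP j (size s)) => [lt_j _|ge_j]; first by rewrite mem_nth.
by rewrite nth_default // size_map.
Qed.

Lemma nth_succn_lt (s : seq nat) j : {in s, forall x, x < U} ->
  nth 0 (map succn s) j < N + U + 2.
Proof.
move=> lt_s; case E : (nth 0 (map succn s) j) => [|x]; first by lia.
by have := lt_s x (nth_map_succn _ _ _ E); lia.
Qed.

Lemma table_lt t i u v : table G d B t i u v < N + U + 2.
Proof.
case: t => [|[|[|[|l]]]] /=.
- by case: u => [|u] /=; [lia|apply: nth_succn_lt => x /outs_lt[]].
- by case: u => [|u] /=; [lia|apply: nth_succn_lt => x /ins_lt[]].
- by case: u v => [|u] [|v] /=; try lia; have := size_outs_le i u; lia.
- by case: v => [|v] /=; [apply: nth_succn_lt => x /heavy_lt[]|lia].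
by case: u v => [|u] [|v] /=; try lia; case: (_ && _); lia.
Qed.

Lemma answer_tab_lt l i u v : answer_tab G d B l i u v != 0 ->
  [/\ l <= k, i < k, u <= U & v <= U].
Proof.
case: u v => [|u] [|v] //=; rewrite eqb0 negbK /is_stored => /andP[uv].
case: eqP uv => [-> uv _|_ _ le_B].
  have [w uw wv] := (walkD G i 1 1 u v).1 uv.
  by move: uw wv; rewrite !walk1 // => /outs_lt[? ? ?] /outs_lt[? ? ?]; split; lia.
have [lt_i lt_u] : i < k /\ u < U by apply: outs_gt0; nia.
have [lt_j lt_v] : (i + l).-1 < k /\ v < U by apply: ins_gt0; nia.
by split=> //; lia.
Qed.

Lemma table_ne0 t i u v : table G d B t i u v != 0 ->
  [/\ t < k + 5, i < k, u < N + U + 2 & v < N + U + 2].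
Proof.
case: t => [|[|[|[|l]]]] /=.
- case: u => [|u] //= /nth_succn_ne0[lt_v /outs_lt[? ? ?]].
  by have := size_outs_le i u; split; lia.
- case: u => [|u] //= /nth_succn_ne0[lt_v /ins_lt[? ? ?]].
  by have := size_ins_le i u; split; lia.
- by case: u v => [|u] [|v] //=; rewrite -lt0n => /outs_gt0[? ?]; split; lia.
- case: v => [|v] //= /nth_succn_ne0[lt_u /heavy_lt[? ?]].
  by have := size_heavy_le i; move: (size _) lt_u => s; split; lia.
by move=> /answer_tab_lt[? ? ? ?]; split; lia.
Qed.

(* [Z] plays the role of |D| * Delta. *)
Hypotheses (N_Z : N <= Z) (light_Z : N * d <= Z)
  (heavy_Z : forall m, m * d.+1 <= N -> N * m <= Z)
  (pairs_Z : forall m, m * B <= N * N -> m <= Z).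

(** The pair [(u, v)] occurs once for each choice of an edge leaving [u] and an edge entering [v],
    so [heavy_hitters] applies to products of degrees. *)
Definition pairs i j := [seq (e.1, e'.2) | e <- G i, e' <- G j].

Lemma count_pairs i j u v :
  count_mem (u, v) (pairs i j) = size (outs G i u) * size (ins G j v).
Proof.
rewrite size_outs size_ins /pairs.
elim: (G i) => [|e s IHs] //=; rewrite count_cat IHs mulnDl; congr (_ + _).
rewrite !count_map; case: eqP => [<-|neq]; last first.
  rewrite mul0n; apply/eqP; rewrite -leqn0 leqNgt -has_count; apply/hasPn => x _ /=.
  by rewrite xpair_eqE; case: eqP.
by rewrite mul1n; apply: eq_count => e' /=; rewrite xpair_eqE eqxx.
Qed.

(** A superset of the nonzero entries with first relation [i], repetitions being allowed. The three
    lists with tag 6 are for the 2-path answers with a light middle vertex, a heavy end and a heavy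
    start. *)
Definition keys_at (i : nat) : seq (nat * nat * nat * nat) :=
  [seq (0, i, e.1.+1, index e.2 (outs G i e.1)) | e <- G i] ++
  [seq (1, i, e.2.+1, index e.1 (ins G i e.2)) | e <- G i] ++
  [seq (2, i, e.1.+1, 0) | e <- G i] ++
  [seq (3, i, m, 0) | m <- iota 0 (size (heavy G d i))] ++
  flatten [seq [seq (6, i, e.1.+1, w.+1) | w <- outs G i.+1 e.2]
            | e <- G i & size (outs G i.+1 e.2) <= d] ++
  [seq (6, i, e.1.+1, x.+1) | e <- G i, x <- heavy G d i.+2] ++
  [seq (6, i, x.+1, e.2.+1) | e <- G i.+1, x <- heavy G d i] ++
  flatten [seq [seq (l.+4, i, ab.1.+1, ab.2.+1)
                 | ab <- undup (pairs i (i + l).-1) & B <= count_mem ab (pairs i (i + l).-1)]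
            | l <- iota 0 (k + 1)].

Lemma size_keys_at i : size (keys_at i) <= (k + 8) * Z.
Proof.
have heavy_le j j' : size (G j) * size (heavy G d j') <= Z.
  apply: leq_trans (heavy_Z _ (leq_trans (size_heavy G d j') (G_N j'))).
  by rewrite leq_mul2r G_N orbT.
have Gi := leq_trans (G_N i) N_Z.
have Hi := leq_trans (size_heavy_le i) N_Z.
have L : size (flatten [seq [seq (6, i, e.1.+1, w.+1) | w <- outs G i.+1 e.2]
            | e <- G i & size (outs G i.+1 e.2) <= d]) <= Z.
  apply: leq_trans light_Z; apply: leq_trans (size_flatten_map_le _ _ _ _ d _) _.
    by move=> e; rewrite mem_filter => /andP[le_d _]; rewrite size_map.
  by rewrite leq_mul2r size_filter (leq_trans (count_size _ _)) ?orbT.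
have A : size (flatten [seq [seq (l.+4, i, ab.1.+1, ab.2.+1)
       | ab <- undup (pairs i (i + l).-1) & B <= count_mem ab (pairs i (i + l).-1)]
            | l <- iota 0 (k + 1)]) <= (k + 1) * Z.
  rewrite -[k + 1 in X in _ <= X](size_iota 0); apply: size_flatten_map_le => l _.
  rewrite size_map; apply: pairs_Z; apply: leq_trans (heavy_hitters _ _ _) _.
  by rewrite size_allpairs leq_mul.
(* One [Z] for each of the first seven lists, and one for each length [l <= k] in the last. *)
have -> : (k + 8) * Z = Z + (Z + (Z + (Z + (Z + (Z + (Z + (k + 1) * Z)))))) by lia.
rewrite /keys_at; do 4 (rewrite size_cat; apply: leq_add; first by rewrite size_map ?size_iota).
rewrite size_cat; apply: leq_add; first exact: L.
do 2 (rewrite size_cat; apply: leq_add; first by rewrite size_allpairs).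
exact: A.
Qed.

Lemma mem_keys_at t i u v : table G d B t i u v != 0 -> (t, i, u, v) \in keys_at i.
Proof.
move=> tab_n0; have [lt_t lt_i _ _] := table_ne0 _ _ _ _ tab_n0.
rewrite 7!mem_cat; move: tab_n0 lt_t; case: t => [|[|[|[|l]]]] /=.
- case: u => [|u] //= /nth_succn_ne0[lt_v v_out] _; apply/orP; left.
  apply/mapP; exists (u, nth 0 (outs G i u) v); first by rewrite -mem_outs.
  by rewrite /= index_uniq // outs_uniq.
- case: u => [|u] //= /nth_succn_ne0[lt_v v_in] _; apply/orP; right; apply/orP; left.
  apply/mapP; exists (nth 0 (ins G i u) v, u); first by rewrite -mem_ins.
  by rewrite /= index_uniq // ins_uniq.
- case: u v => [|u] [|v] //=; case E : (outs G i u) => [|w s] // _ _.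
  apply/orP; right; apply/orP; right; apply/orP; left.
  by apply/mapP; exists (u, w); rewrite // -mem_outs E mem_head.
- case: v => [|v] //= /nth_succn_ne0[lt_u _] _.
  do 3 (apply/orP; right); apply/orP; left.
  by apply/mapP; exists u; rewrite // mem_iota.
case: u v => [|u] [|v] //=; rewrite eqb0 negbK /is_stored => /andP[uv].
case: eqP uv => [-> uv | _ _ le_B] => [|lt_l].
  have [w uw wv] := (walkD G i 1 1 u v).1 uv; rewrite !walk1 // addn1 in uw wv.
  rewrite mem_outs in uw; case/or3P => [light|heavy_u|heavy_v] _.
  - do 4 (apply/orP; right); apply/orP; left.
    case/hasP: light => x; rewrite mem_outs => ux /andP[xv light_x].
    apply/flatten_mapP; exists (u, x); first by rewrite mem_filter light_x.
    by apply/mapP; exists v.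
  - do 6 (apply/orP; right); apply/orP; left.
    apply/allpairsP; exists ((w, v), u); split=> //=; first by rewrite -mem_outs.
    by rewrite mem_heavy.
  do 5 (apply/orP; right); apply/orP; left.
  by apply/allpairsP; exists ((u, w), v); split; rewrite //= mem_heavy.
do 7 (apply/orP; right).
apply/flatten_mapP; exists l; first by rewrite mem_iota; lia.
apply/mapP; exists (u, v) => //.
have le_c : B <= count_mem (u, v) (pairs i (i + l).-1) by rewrite count_pairs.
by rewrite mem_filter le_c mem_undup -has_pred1 has_count (leq_trans _ le_c).
Qed.

Lemma table_support : exists2 S : seq (nat * nat * nat * nat),
  size S <= k * ((k + 8) * Z) &
  forall t i u v, table G d B t i u v != 0 -> (t, i, u, v) \in S.
Proof.
exists (flatten [seq keys_at i | i <- iota 0 k]).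
  rewrite -{2}[k](size_iota 0); apply: size_flatten_map_le => i _.
  exact: size_keys_at.
move=> t i u v tab_n0; apply/flatten_mapP; exists i; last exact: mem_keys_at.
by have [_ lt_i _ _] := table_ne0 _ _ _ _ tab_n0; rewrite mem_iota.
Qed.

End Support.

(** * The search as an expression *)

(** The quadruple in mixed radix: [t] is the leading digit, followed by [i] in base [k] and by [u]
    and [v] in base [X], which is read from the header. *)
Definition Ekey (k t : nat) (i u v : expr) : expr :=
  let X := Mem (Cst 3) in
  Bin Add (Bin Mul (Bin Add (Bin Mul (Bin Add (Cst (t * k)) i) X) u) X) v.

Definition Etable (k t : nat) (i u v : expr) : expr := Elookup (Ekey k t i u v).

(* The tag [l.+4] selects [answer_tab l], and [left] is the truth value of
   [D <= R]. Subterms are duplicated freely: the size of the expression depends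
   on [k] only. *)
Fixpoint Etrial (k l : nat) (i a b n : expr) : expr :=
  let D := Etable k 2 i a (Cst 0) in
  Bin Add (Etable k (l + 4).+4 i a b)
  (if l is l'.+1 then
    let R := Mem (Cst 4) in
    let left := Bin Sub (Cst 1) (Bin Sub D R) in
    let right := Bin Sub (Cst 1) left in
    Etrial k l' (Bin Add i left)
      (Bin Add (Bin Mul left (Etable k 0 i a (Emod n R))) (Bin Mul right a))
      (Bin Add (Bin Mul left b)
         (Bin Mul right (Etable k 1 (Bin Add i (Cst (l' + 4))) b (Emod n R))))
      (Bin Div n R)
  else
    let h := Etable k 3 (Bin Add i (Cst 2)) n (Cst 0) in
    Bin Add
      (Etable k 6 (Bin Add i (Cst 1)) (Etable k 0 i a (Emod n D))
         (Etable k 1 (Bin Add i (Cst 3)) b (Bin Div n D)))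
      (Bin Mul (Etable k 6 i a h) (Etable k 6 (Bin Add i (Cst 2)) h b))).

Lemma vars_below_Etable t k j i u v : vars_below t i -> vars_below t u ->
  vars_below t v -> vars_below t (Etable k j i u v).
Proof. by move=> iP uP vP; rewrite /= iP uP vP. Qed.

Lemma vars_below_Bin t o e1 e2 : vars_below t e1 -> vars_below t e2 ->
  vars_below t (Bin o e1 e2).
Proof. by move=> /= -> ->. Qed.

(* Matching on the syntax keeps unification from unfolding [Elookup]. *)
Ltac by_structure table_lemma bin_lemma :=
  repeat lazymatch goal with
  | |- is_true (_ (Etable _ _ _ _ _)) => apply: table_lemma
  | |- is_true (_ (Bin _ _ _)) => apply: bin_lemma
  | |- is_true (_ (Emod _ _)) => apply: bin_lemma
  | |- _ => done
  end.

Lemma vars_below_Etrial t k l i a b n : vars_below t i -> vars_below t a ->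
  vars_below t b -> vars_below t n -> vars_below t (Etrial k l i a b n).
Proof.
elim: l i a b n => [|l IHl] i a b n iP aP bP nP;
  have DP : vars_below t (Etable k 2 i a (Cst 0)) by apply: vars_below_Etable.
  by cbv beta iota zeta delta [Etrial]; by_structure vars_below_Etable vars_below_Bin.
apply: vars_below_Bin; first exact: vars_below_Etable.
by apply: IHl; by_structure vars_below_Etable vars_below_Bin.
Qed.

Definition table_fun (T : nat -> nat -> nat -> nat -> nat) (k X x : nat) : nat :=
  T (x %/ X %/ X %/ k) (x %/ X %/ X %% k) (x %/ X %% X) (x %% X).

Definition key (k X t i u v : nat) : nat := ((t * k + i) * X + u) * X + v.

Lemma table_fun_key T k X t i u v : i < k -> u < X -> v < X ->
  table_fun T k X (key k X t i u v) = T t i u v.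
Proof.
move=> lt_i lt_u lt_v; rewrite /table_fun /key.
have [k_gt0 X_gt0] : 0 < k /\ 0 < X by lia.
rewrite divnMDl // (divn_small lt_v) addn0 divnMDl // (divn_small lt_u) addn0.
by rewrite divnMDl // (divn_small lt_i) addn0 !modnMDl !modn_small.
Qed.

Lemma keyE k X x : key k X (x %/ X %/ X %/ k) (x %/ X %/ X %% k) (x %/ X %% X) (x %% X) = x.
Proof. by rewrite /key -!divn_eq. Qed.

Section Evaluation.

Variables (M : seq nat) (G : nat -> seq (nat * nat)) (d B R k X Y : nat).
Hypotheses (M_dict : dictionary M (table_fun (table G d B) k X))
  (M_size : 5 < size M) (M_X : nth 0 M 3 = X) (M_R : nth 0 M 4 = R)
  (table_ltX : forall t i u v, table G d B t i u v < X).

Lemma in_range_Etable rg t i u v : in_range M rg i -> in_range M rg u ->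
  in_range M rg v -> in_range M rg (Etable k t i u v).
Proof.
move=> iP uP vP; apply: (M_dict _ _ _).1.
by rewrite /= iP uP vP; lia.
Qed.

Lemma in_range_Etrial rg l i a b n : in_range M rg i -> in_range M rg a ->
  in_range M rg b -> in_range M rg n -> in_range M rg (Etrial k l i a b n).
Proof.
have RP : in_range M rg (Mem (Cst 4)) by rewrite /=; lia.
elim: l i a b n => [|l IHl] i a b n iP aP bP nP;
  have DP : in_range M rg (Etable k 2 i a (Cst 0)) by apply: in_range_Etable.
  by cbv beta iota zeta delta [Etrial]; by_structure in_range_Etable in_range_Bin.
apply: in_range_Bin; first exact: in_range_Etable.
by apply: IHl; by_structure in_range_Etable in_range_Bin.
Qed.

Definition evaluates rg e n : Prop := in_range M rg e /\ eval M rg e = n.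

Lemma evaluates_Bin rg o e1 e2 n1 n2 : evaluates rg e1 n1 -> evaluates rg e2 n2 ->
  evaluates rg (Bin o e1 e2) (eval_binop o n1 n2).
Proof. by move=> [in1 <-] [in2 <-]; split=> //=; rewrite in1. Qed.

Lemma evaluates_Emod rg e1 e2 n1 n2 : evaluates rg e1 n1 -> evaluates rg e2 n2 ->
  evaluates rg (Emod e1 e2) (n1 %% n2).
Proof.
by move=> [in1 <-] [in2 <-]; split; rewrite ?eval_Emod //= in1 in2.
Qed.

Lemma evaluates_Etable rg t i u v ni nu nv :
  evaluates rg i ni -> evaluates rg u nu -> evaluates rg v nv ->
  ni < k -> nu < X -> nv < X ->
  evaluates rg (Etable k t i u v) (table G d B t ni nu nv).
Proof.
move=> [iP iE] [uP uE] [vP vE] lt_i lt_u lt_v; split; first exact: in_range_Etable.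
rewrite (M_dict _ _ _).2; last by rewrite /= iP uP vP; lia.
by rewrite -(table_fun_key _ _ _ t _ _ _ lt_i lt_u lt_v) /key -iE -uE -vE /= M_X.
Qed.

(** The invariant [ni + l + 4 <= k] keeps every relation number below [k], as the decoding of keys
    requires. Both kinds of recursive call preserve it, since [ni] grows by at most one while [l]
    drops by one. *)
Lemma evaluates_Etrial rg l i a b n ni na nb nn :
  evaluates rg i ni -> evaluates rg a na -> evaluates rg b nb -> evaluates rg n nn ->
  ni + l + 4 <= k -> na < X -> nb < X -> nn < X ->
  evaluates rg (Etrial k l i a b n) (trial G d B R l ni na nb nn).
Proof.
have X_gt0 : 0 < X := leq_ltn_trans (leq0n _) (table_ltX 0 0 0 0).
have RE : evaluates rg (Mem (Cst 4)) R by split=> //=; lia.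
have CE m : evaluates rg (Cst m) m by [].
have lt_mod x y : x < X -> x %% y < X by apply: leq_ltn_trans; apply: leq_mod.
have lt_div x y : x < X -> x %/ y < X by apply: leq_ltn_trans; apply: leq_div.
elim: l i a b n ni na nb nn => [|l IHl] i a b n ni na nb nn iE aE bE nE le_k lt_a lt_b lt_n.
  have DE : evaluates rg (Etable k 2 i a (Cst 0)) (degree_tab G ni na 0).
    by apply: (evaluates_Etable _ 2) => //; lia.
  have addE m : evaluates rg (Bin Add i (Cst m)) (ni + m) by apply: evaluates_Bin.
  have hE : evaluates rg (Etable k 3 (Bin Add i (Cst 2)) n (Cst 0)) (heavy_tab G d ni.+2 nn 0).
    by rewrite -(addn2 ni); apply: (evaluates_Etable _ 3 _ _ _ (ni + 2) nn 0) => //; lia.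
  have lt_h : heavy_tab G d ni.+2 nn 0 < X := table_ltX 3 ni.+2 nn 0.
  have xE : evaluates rg (Etable k 0 i a (Emod n (Etable k 2 i a (Cst 0))))
      (out_tab G ni na (nn %% degree_tab G ni na 0)).
    by apply: (evaluates_Etable _ 0) => //; [exact: evaluates_Emod|lia|exact: lt_mod].
  have yE : evaluates rg (Etable k 1 (Bin Add i (Cst 3)) b (Bin Div n (Etable k 2 i a (Cst 0))))
      (in_tab G (ni + 3) nb (nn %/ degree_tab G ni na 0)).
    by apply: (evaluates_Etable _ 1) => //; [exact: (evaluates_Bin _ Div)|lia|exact: lt_div].
  have lt_x := table_ltX 0 ni na (nn %% degree_tab G ni na 0).
  have lt_y := table_ltX 1 (ni + 3) nb (nn %/ degree_tab G ni na 0).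
  rewrite trial0E; apply: (evaluates_Bin _ Add); first by apply: (evaluates_Etable _ 8) => //; lia.
  apply: (evaluates_Bin _ Add).
    by rewrite -(addn1 ni); apply: (evaluates_Etable _ 6) => //; lia.
  apply: (evaluates_Bin _ Mul); first by apply: (evaluates_Etable _ 6) => //; lia.
  by rewrite -[X in answer_tab G d B 2 X _ nb](addn2 ni); apply: (evaluates_Etable _ 6) => //; lia.
have DE : evaluates rg (Etable k 2 i a (Cst 0)) (degree_tab G ni na 0).
  by apply: (evaluates_Etable _ 2) => //; lia.
have leftE : evaluates rg (Bin Sub (Cst 1) (Bin Sub (Etable k 2 i a (Cst 0)) (Mem (Cst 4))))
    (degree_tab G ni na 0 <= R).
  have := evaluates_Bin _ Sub _ _ _ _ (CE 1) (evaluates_Bin _ Sub _ _ _ _ DE RE).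
  by congr evaluates; rewrite /=; lia.
have rightE := evaluates_Bin _ Sub _ _ _ _ (CE 1) leftE.
have rE := evaluates_Emod _ _ _ _ _ nE RE.
have xE : evaluates rg (Etable k 0 i a (Emod n (Mem (Cst 4)))) (out_tab G ni na (nn %% R)).
  by apply: (evaluates_Etable _ 0) => //; [lia|exact: lt_mod].
have yE : evaluates rg (Etable k 1 (Bin Add i (Cst (l + 4))) b (Emod n (Mem (Cst 4))))
    (in_tab G (ni + l.+1 + 3) nb (nn %% R)).
  rewrite (_ : ni + l.+1 + 3 = ni + (l + 4)); last by lia.
  by apply: (evaluates_Etable _ 1) => //; [exact: evaluates_Bin|lia|exact: lt_mod].
have lt_x := table_ltX 0 ni na (nn %% R).
have lt_y := table_ltX 1 (ni + l.+1 + 3) nb (nn %% R).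
rewrite trialS; apply: (evaluates_Bin _ Add).
  by apply: (evaluates_Etable _ (l.+1 + 4).+4) => //; lia.
(* As [left] is 0 or 1, arithmetic combinations select the arguments of a single recursive call in
   place of a branch. *)
pose left := nat_of_bool (degree_tab G ni na 0 <= R).
have -> : (if degree_tab G ni na 0 <= R
    then trial G d B R l ni.+1 (out_tab G ni na (nn %% R)) nb (nn %/ R)
    else trial G d B R l ni na (in_tab G (ni + l.+1 + 3) nb (nn %% R)) (nn %/ R)) =
  trial G d B R l (ni + left) (left * out_tab G ni na (nn %% R) + (1 - left) * na)
    (left * nb + (1 - left) * in_tab G (ni + l.+1 + 3) nb (nn %% R)) (nn %/ R).
  by rewrite /left; case: (_ <= R); rewrite ?addn1 ?addn0 ?mul1n ?subnn ?mul0n ?addn0 ?add0n.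
apply: IHl.
- exact: (evaluates_Bin _ Add).
- by apply: (evaluates_Bin _ Add); apply: (evaluates_Bin _ Mul).
- by apply: (evaluates_Bin _ Add); apply: (evaluates_Bin _ Mul).
- exact: (evaluates_Bin _ Div).
- by rewrite /left; case: (_ <= R); lia.
- by rewrite /left; case: (_ <= R); rewrite ?mul1n ?subnn ?mul0n ?addn0 ?add0n.
- by rewrite /left; case: (_ <= R); rewrite ?mul1n ?subnn ?mul0n ?addn0 ?add0n.
exact: lt_div.
Qed.

End Evaluation.

(** * The data structure *)

(** Empty relations from index [k] on free the index arithmetic from ordinals. *)
Definition rel_at {k : nat} (D : database k) (i : nat) : seq (nat * nat) :=
  if insub i is Some i' then enum_fset (D i') else [::].

Lemma rel_at_ord {k} (D : database k) (i : 'I_k) e : (e \in rel_at D i) = (e \in D i).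
Proof. by rewrite /rel_at valK. Qed.

Lemma rel_at_uniq {k} (D : database k) i : uniq (rel_at D i).
Proof. by rewrite /rel_at; case: insub => [i'|] //; apply: fset_uniq. Qed.

Lemma rel_at_nil {k} (D : database k) i : k <= i -> rel_at D i = [::].
Proof. by move=> le_ki; rewrite /rel_at insubF // ltnNge le_ki. Qed.

Lemma size_rel_at {k} (D : database k) i : size (rel_at D i) <= dbsize D.
Proof.
rewrite /rel_at; case: insub => [i'|] //=.
by rewrite /dbsize (bigD1 i') //= leq_addr.
Qed.

Lemma walkP G i l u v : walk G i l u v <->
  exists x : nat -> nat, [/\ x 0 = u, x l = v
    & forall j, j < l -> (x j, x j.+1) \in G (i + j)].
Proof.
elim: l i u => [|l IHl] i u /=.
  by split=> [/eqP->|[x [<- <- _]] //]; exists (fun=> v).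
split=> [/hasP[w uw /IHl[x [x0 xl xG]]]|[x [x0 xl xG]]].
  exists (fun j => if j is j'.+1 then x j' else u); split=> // -[|j] lt_j.
    by rewrite x0 addn0 -mem_outs.
  by rewrite addnS -addSn; apply: xG.
apply/hasP; exists (x 1); first by rewrite mem_outs -x0 -[i]addn0 xG.
apply/IHl; exists (x \o succn); split=> //= j lt_j.
by rewrite addSn -addnS; apply: xG.
Qed.

Lemma path_query_walk {k} (D : database k) a b :
  path_query D a b <-> walk (rel_at D) 0 k a b.
Proof.
rewrite walkP; split=> [[x [x0 xk xD]]|[x [x0 xk xD]]].
  exists (fun j => x (inord j)); split=> [||j lt_j].
  - by rewrite -x0; congr x; apply: val_inj; rewrite /= inordK.
  - by rewrite -xk; congr x; apply: val_inj; rewrite /= inordK.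
  have -> : inord j = widen_ord (leqnSn k) (Ordinal lt_j).
    by apply: val_inj; rewrite /= inordK // ltnW.
  have -> : inord j.+1 = lift ord0 (Ordinal lt_j) by apply: val_inj; rewrite /= inordK.
  by rewrite add0n (rel_at_ord D (Ordinal lt_j)).
exists (fun j => x j); split=> // i.
by rewrite -rel_at_ord; have := xD i (ltn_ord i); rewrite add0n.
Qed.

(* Word 3 of the header holds the radix [X] of the keys, word 4 the bound [R]
   on the degrees that are enumerated, word 5 the number of trials. *)
Definition trial_expr (k : nat) : expr :=
  Etrial k (k - 4) (Cst 0) (Bin Add (Var 0) (Cst 1)) (Bin Add (Var 1) (Cst 1)) (Var 2).

(* Keys are below [Q = k * (k + 5) * Y ^ (2 * k) + 7], where [Y = |D| + U + 2],
   and memory words below [10 * Q.+1 ^ 2]. *)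
Definition word_exp (k : nat) : nat := 2 * (k * (k + 5) + 8 + 2 * k) + 4.

(** The construction for abstract integer thresholds: [d] for heaviness, [B] for products of
    degrees, [R] for enumerated degrees, [Z] for space. *)
Lemma data_structure {k} (D : database k) U d B R Z c : 4 <= k ->
  constants_below U D -> 0 < B -> 0 < R -> B <= R.+1 ^ 2 ->
  R < dbsize D + U + 2 -> B < dbsize D + U + 2 ->
  dbsize D <= Z -> dbsize D * d <= Z ->
  (forall m, m * d.+1 <= dbsize D -> m < B /\ dbsize D * m <= Z) ->
  (forall m, m * B <= dbsize D * dbsize D -> m <= Z) ->
  word_exp k <= c -> deg (word_exp k) (trial_expr k) <= c ->
  exists M, [/\ size M <= 40 * (k * ((k + 8) * Z)).+1,
    all (ltn^~ (word_bound (word_exp k) (dbsize D) U)) M &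
    forall a b, a < U -> b < U ->
    exists2 t, t <= (R ^ (k - 4) * B).+1 * (size (compile (trial_expr k) 3) + 7) &
    answers_in (word_bound c (dbsize D) U) (search (trial_expr k)) M a b
      (path_query D a b) t].
Proof.
move=> k_ge4 D_U B_gt0 R_gt0 leB lt_R lt_B N_Z light_Z heavy_Z pairs_Z le_c deg_c.
rewrite /word_bound; set N := dbsize D in lt_R lt_B N_Z light_Z heavy_Z pairs_Z *.
set Y := N + U + 2 in lt_R lt_B *; set G := rel_at D.
have Y_gt1 : 1 < Y by rewrite /Y; lia.
have Y_gt0 := ltnW Y_gt1.
have G_uniq : forall i, uniq (G i) := rel_at_uniq D.
have G_k : forall i, k <= i -> G i = [::] := rel_at_nil D.
have G_N : forall i, size (G i) <= N := size_rel_at D.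
have G_U i e : e \in G i -> e.1 < U /\ e.2 < U.
  rewrite /G /rel_at; case: insubP => [i' _ _|//]; exact: D_U.
(* The radix [X] has to exceed vertices and degrees, and also the counter, which starts at [T] and
   serves as an index into the tables. *)
pose T := R ^ (k - 4) * B; pose X := Y ^ k.
have lt_TX : T < X.
  apply: leq_ltn_trans (_ : Y ^ (k - 4) * Y < _).
    apply: leq_mul; last exact: ltnW.
    by case: (k - 4) => // n; rewrite leq_exp2r // (ltnW lt_R).
  by rewrite -expnSr ltn_exp2l //; lia.
have le_YX : Y <= X by rewrite /X -{1}[Y]expn1 leq_pexp2l //; lia.
pose f := table_fun (table G d B) k X.
have lt_tab t i u v : table G d B t i u v < Y by apply: (table_lt G d B k).
have heavyZ m : m * d.+1 <= N -> N * m <= Z by case/heavy_Z.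
have [S0 size_S0 tab_S0] := table_support G d B k N U Z G_uniq G_k G_N B_gt0 G_U
   N_Z light_Z heavyZ pairs_Z.
pose enc (x : nat * nat * nat * nat) := let: (t, i, u, v) := x in key k X t i u v.
(* Dropping the keys of value 0 makes [table_ne0] applicable to the others, which bounds them by
   [Q]. *)
pose S := [seq x <- undup (map enc S0) | f x != 0].
have f_S x : f x != 0 -> x \in S.
  move=> fx; rewrite mem_filter fx mem_undup; apply/mapP.
  eexists; first exact: tab_S0 fx.
  by rewrite /enc keyE.
(* The summand 7 meets the condition [6 < Q] of [exists_prime_between]. *)
pose Q := k * (k + 5) * X ^ 2 + 7.
have lt_SQ : all (ltn^~ Q) S.
  apply/allP => x; rewrite mem_filter => /andP[fx _].
  have [lt_t lt_i lt_u lt_v] := table_ne0 G d B k N U G_k G_N B_gt0 G_U _ _ _ _ fx.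
  rewrite -(keyE k X x) /key /Q -mulnn.
  move: (x %/ X %/ X %/ k) (x %/ X %/ X %% k) (x %/ X %% X) (x %% X) lt_t lt_i lt_u lt_v.
  move=> t i u v lt_t lt_i lt_u lt_v.
  have {}lt_u : u < X by apply: leq_trans lt_u le_YX.
  have {}lt_v : v < X by apply: leq_trans lt_v le_YX.
  have le1 : t * k + i < k * (k + 5) by nia.
  have le2 : (t * k + i) * X + u < k * (k + 5) * X by nia.
  apply: (@leq_trans (((t * k + i) * X + u).+1 * X)); first by rewrite mulSn addnC ltn_add2r.
  by rewrite mulnA (leq_trans (leq_mul le2 (leqnn X))) // leq_addr.
have uS : uniq S by rewrite filter_uniq // undup_uniq.
have size_SQ : size S <= Q.
  rewrite -(size_iota 0 Q); apply: uniq_leq_size => // x /(allP lt_SQ).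
  by rewrite mem_iota.
have [p p_pr /andP[lt_Qp le_p]] := exists_prime_between Q (leq_addl _ _).
pose w := Y ^ word_exp k.
have lt_Qw : 10 * Q.+1 ^ 2 < w.
  have X_gt0 : 0 < X := leq_trans Y_gt0 le_YX.
  have Q_lt : Q.+1 <= Y ^ (k * (k + 5) + 8 + 2 * k).
    rewrite expnD (mulnC 2) expnM -/X; apply: (@leq_trans ((k * (k + 5) + 8) * X ^ 2)).
      by rewrite /Q -mulnn; nia.
    by rewrite leq_mul2r (ltnW (ltn_expl _ _)) ?orbT.
  rewrite /w /word_exp addnC expnD (mulnC 2) expnM.
  apply: (@leq_ltn_trans (10 * (Y ^ (k * (k + 5) + 8 + 2 * k)) ^ 2)).
    by rewrite leq_mul2l leq_exp2r.
  rewrite ltn_mul2r !expn_gt0 Y_gt0 /=; apply: (@leq_trans (2 ^ 4)) => //.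
  by rewrite leq_exp2r.
have lt_pw : p < w by apply: leq_ltn_trans le_p _; apply: leq_ltn_trans lt_Qw; rewrite -!mulnn; nia.
have lt_Xw : X < w.
  by rewrite ltn_exp2l // /word_exp; nia.
have lt_S_p : all (ltn^~ p) S.
  by apply/allP => x /(allP lt_SQ) lt_x; apply: ltn_trans lt_x lt_Qp.
have lt_Sw : 9 * (size S).+1 ^ 2 < w.
  by apply: leq_ltn_trans lt_Qw; rewrite leq_mul // leq_exp2r.
have lt_fw x : f x < w.
  exact: leq_trans (lt_tab _ _ _ _) (leq_trans le_YX (ltnW lt_Xw)).
have lt_hdr : all (ltn^~ w) [:: X; R; T].
  by rewrite /= lt_Xw (ltn_trans lt_TX lt_Xw) (ltn_trans (leq_trans lt_R le_YX) lt_Xw).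
have [M [dictM lt_M size_M [M_ge6 M3 M4 M5]]] :=
  exists_dictionary f S p w X R T f_S lt_S_p p_pr uS lt_pw lt_Sw lt_fw lt_hdr.
exists M; split.
- apply: leq_trans size_M _; rewrite leq_mul2l ltnS (leq_trans _ size_S0) //.
  by rewrite size_filter (leq_trans (count_size _ _)) // (leq_trans (size_undup _)) ?size_map.
- exact: lt_M.
move=> a b lt_a lt_b.
have tab_X t i u v : table G d B t i u v < X := leq_trans (lt_tab t i u v) le_YX.
have lt_Yw : Y < w by apply: leq_ltn_trans le_YX lt_Xw.
have lt_aw : a < w by rewrite /Y in lt_Yw; lia.
have lt_bw : b < w by rewrite /Y in lt_Yw; lia.
have c_gt5 : 5 < Y ^ c.
  apply: (@leq_trans (Y ^ 4)); first by apply: (@leq_trans (2 ^ 4)); rewrite ?leq_exp2r.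
  by rewrite leq_pexp2l // (leq_trans _ le_c) // /word_exp; lia.
have vars_E : vars_below 3 (trial_expr k) by apply: vars_below_Etrial.
have in_E rg : in_range M rg (trial_expr k).
  by apply: (in_range_Etrial M G d B R k X dictM M_ge6 M3 M4).
have [t le_t [s [run_s halt_s mem_s ans_s]]] :=
  search_correct Y (word_exp k) c M (trial_expr k) a b Y_gt1 lt_M lt_aw lt_bw c_gt5 le_c M_ge6
    vars_E deg_c in_E.
rewrite M5 in le_t ans_s.
exists t => //; exists s; split=> //; rewrite ans_s path_query_walk.
have eval_E n : n <= T -> eval M (trial_env a b n) (trial_expr k) =
    trial G d B R (k - 4) 0 a.+1 b.+1 n.
  move=> le_n; rewrite -(addn1 a) -(addn1 b).
  suff [] : evaluates M (trial_env a b n) (trial_expr k)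
    (trial G d B R (k - 4) 0 (a + 1) (b + 1) n) by [].
  apply: (evaluates_Etrial M G d B R k X dictM M_ge6 M3 M4 tab_X) => //.
  - by rewrite add0n subnK.
  - by rewrite /Y in le_YX; lia.
  - by rewrite /Y in le_YX; lia.
  exact: leq_ltn_trans lt_TX.
have k_E : k - 4 + 4 = k by rewrite subnK.
(* The search also tries [n = T], beyond the range given by completeness; soundness holds for every
   [n]. *)
split=> [[n le_n]|].
  rewrite eval_E // => /eqP/trial_sound[a' [b' [[<-] [<-]]]].
  by rewrite k_E.
move=> ab; have {}ab : walk G 0 (k - 4 + 4) a b by rewrite k_E.
have [|n lt_n /eqP tr_n] := trial_complete G d B R R_gt0 B_gt0 leB _ _ _ _ _ ab.
  move=> i; case: (heavy_Z (size (heavy G d i))) => //.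
  exact: leq_trans (size_heavy G d i) (G_N i).
by exists n; rewrite ?eval_E // ltnW.
Qed.

(** * Choice of the thresholds *)

Local Open Scope ring_scope.

Section Thresholds.

Variables (R : realType) (N : nat) (Delta : R).
Hypothesis Delta_ge : Num.sqrt N%:R <= Delta.

(** The thresholds will be [d = truncn Delta], [B = truncn beta + 1], [R = truncn (sqrt beta) + 1]
    and [Z = truncn (N * Delta)]; the successors keep [B] and [R] positive when [beta < 1]. *)
Let beta : R := N%:R / Delta.

Lemma Delta_ge0 : 0 <= Delta.
Proof. exact: le_trans (sqrtr_ge0 _) Delta_ge. Qed.

(** For positive [Delta] this is [N / Delta <= Delta]: there are at most [Delta] heavy vertices, and
    each can be paired with every edge in space [N * Delta]. *)
Lemma leN_sqr : N%:R <= Delta ^+ 2.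
Proof.
rewrite -[leLHS]sqr_sqrtr ?ler0n //.
by rewrite ler_pXn2r // nnegrE ?sqrtr_ge0 ?Delta_ge0.
Qed.

Lemma Delta_ge1 : (0 < N)%N -> 1 <= Delta.
Proof.
by move=> N_gt0; apply: le_trans Delta_ge; rewrite -[leLHS]sqrtr1 ler_wsqrtr // ler1n.
Qed.

Lemma beta_ge0 : 0 <= beta.
Proof. by rewrite divr_ge0 ?Delta_ge0. Qed.

Lemma beta_leN : beta <= N%:R.
Proof.
rewrite /beta; case: (posnP N) => [->|N_gt0]; first by rewrite mul0r.
have D1 := Delta_ge1 N_gt0.
by rewrite ler_pdivrMr ?(lt_le_trans ltr01) // ler_peMr.
Qed.

Lemma leN_trunc : (N <= Num.truncn (N%:R * Delta))%N.
Proof.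
rewrite truncn_ge_nat ?mulr_ge0 ?Delta_ge0 //.
case: (posnP N) => [->|N_gt0]; first by rewrite mul0r.
by rewrite ler_peMr // Delta_ge1.
Qed.

Lemma light_trunc : (N * Num.truncn Delta <= Num.truncn (N%:R * Delta))%N.
Proof.
rewrite truncn_ge_nat ?mulr_ge0 ?Delta_ge0 // natrM ler_wpM2l //.
by rewrite truncn_le Delta_ge0.
Qed.

Lemma heavy_trunc m : (m * (Num.truncn Delta).+1 <= N)%N ->
  (m < (Num.truncn beta).+1)%N /\ (N * m <= Num.truncn (N%:R * Delta))%N.
Proof.
case: (posnP m) => [->|m_gt0 le_m]; first by rewrite muln0.
have N_gt0 : (0 < N)%N by lia.
have D_gt0 : 0 < Delta by apply: lt_le_trans (Delta_ge1 N_gt0).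
have le_mD : m%:R * Delta <= N%:R.
  apply: le_trans (_ : m%:R * (Num.truncn Delta).+1%:R <= _).
    by rewrite ler_wpM2l // ltW // truncnS_gt.
  by rewrite -natrM ler_nat.
split; first by rewrite ltnS truncn_ge_nat ?beta_ge0 // ler_pdivlMr.
rewrite truncn_ge_nat ?mulr_ge0 ?Delta_ge0 // natrM ler_wpM2l //.
rewrite -(ler_pM2r D_gt0); apply: le_trans le_mD _.
by rewrite -expr2 leN_sqr.
Qed.

Lemma pairs_trunc m : (m * (Num.truncn beta).+1 <= N * N)%N ->
  (m <= Num.truncn (N%:R * Delta))%N.
Proof.
case: (posnP N) => [->|N_gt0 le_m]; first by rewrite mul0n; lia.
have D_gt0 : 0 < Delta by apply: lt_le_trans (Delta_ge1 N_gt0).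
rewrite truncn_ge_nat ?mulr_ge0 ?Delta_ge0 //.
have : m%:R * beta <= N%:R * N%:R.
  apply: le_trans (_ : m%:R * (Num.truncn beta).+1%:R <= _).
    by rewrite ler_wpM2l // ltW // truncnS_gt.
  by rewrite -!natrM ler_nat.
by rewrite /beta mulrCA ler_pM2l ?ltr0n // ler_pdivrMr.
Qed.

Lemma leq_trunc_sqr :
  ((Num.truncn beta).+1 <= (Num.truncn (Num.sqrt beta)).+2 ^ 2)%N.
Proof.
apply: (@leq_trans ((Num.truncn (Num.sqrt beta)).+1 ^ 2)); last by rewrite leq_exp2r.
rewrite truncn_lt_nat ?beta_ge0 // natrX -[ltLHS]sqr_sqrtr ?beta_ge0 //.
by rewrite ltr_pXn2r ?nnegrE ?sqrtr_ge0 // truncnS_gt.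
Qed.

Lemma trunc_beta_le : (Num.truncn beta <= N)%N.
Proof. by rewrite truncn_le_nat (le_lt_trans beta_leN) // ltr_nat. Qed.

Lemma trunc_sqrt_le : (Num.truncn (Num.sqrt beta) <= N)%N.
Proof.
rewrite truncn_le_nat; apply: (@le_lt_trans _ _ N%:R); last by rewrite ltr_nat.
rewrite -[leRHS](ger0_norm (ler0n R N)) -sqrtr_sqr.
apply: ler_wsqrtr; apply: le_trans beta_leN _.
by rewrite -natrX ler_nat; nia.
Qed.

(** With [m = max 1 (sqrt beta)], the rounded thresholds are at most [2m] and [(2m) ^ 2], so the
    count is at most [(2m) ^ (k - 2)]. The summand 1 covers [beta < 1]. *)
Lemma trials_le k : (4 <= k)%N ->
  ((Num.truncn (Num.sqrt beta)).+1 ^ (k - 4) * (Num.truncn beta).+1)%:R <=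
  (2 ^ k)%:R * (1 + beta `^ ((k%:R - 2) / 2)).
Proof.
move=> k_ge4; pose s := Num.sqrt beta; pose m := Num.max 1 s.
have s_ge0 : 0 <= s := sqrtr_ge0 _.
have beta_s : beta = s ^+ 2 by rewrite sqr_sqrtr ?beta_ge0.
have m_ge1 : 1 <= m by rewrite le_max lexx.
have s_le : s <= m by rewrite le_max lexx orbT.
have R_le : (Num.truncn s).+1%:R <= 2 * m.
  rewrite -natr1; have : (Num.truncn s)%:R <= s by rewrite truncn_le.
  lra.
have B_le : (Num.truncn beta).+1%:R <= (2 * m) ^+ 2.
  rewrite -natr1; have : (Num.truncn beta)%:R <= beta by rewrite truncn_le beta_ge0.
  rewrite beta_s; nra.
have pow_le : m ^+ (k - 2) <= 1 + beta `^ ((k%:R - 2) / 2).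
  have -> : beta `^ ((k%:R - 2) / 2) = s ^+ (k - 2).
    rewrite mulrC powRrM powR12_sqrt ?beta_ge0 // -/s.
    by rewrite -natrB ?powR_mulrn //; lia.
  rewrite /m; case: (leP 1 s) => _; first by rewrite lerDr.
  by rewrite expr1n lerDl exprn_ge0.
rewrite natrM natrX; apply: (@le_trans _ _ ((2 * m) ^+ (k - 4) * (2 * m) ^+ 2)).
  by apply: ler_pM => //; rewrite ?exprn_ge0 // lerXn2r ?nnegrE //; lra.
rewrite -exprD (_ : k - 4 + 2 = k - 2)%N; last by lia.
rewrite exprMn natrX ler_pM ?exprn_ge0 //; first lra.
by rewrite ler_weXn2l ?ler1n //; lia.
Qed.

End Thresholds.

Theorem theorem4 (R : realType) (k : nat) (hk : (4 <= k)%N) :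
  exists (P : program) (c : nat),
  forall (D : database k) (U : nat) (Delta : R),
    constants_below U D ->
    Num.sqrt (dbsize D)%:R <= Delta ->
    exists M : seq nat,
      [/\ (size M)%:R <= c%:R * (1 + (dbsize D)%:R * Delta),
          forall v : nat, v \in M -> (v < word_bound c (dbsize D) U)%N
        & forall a b : nat, (a < U)%N -> (b < U)%N ->
          exists t : nat,
            t%:R <= c%:R * (1 + ((dbsize D)%:R / Delta) `^ ((k%:R - 2) / 2))
            /\ answers_in (word_bound c (dbsize D) U) P M a b
                 (path_query D a b) t].
Proof.
pose s := (size (compile (trial_expr k) 3) + 7)%N.
(* [c1] is the factor for space. In [c2], [2 ^ k] comes from [trials_le], its successor pays for the
   extra trial, and [s] bounds the cost of one trial. All depend on [k] only. *)
pose c1 := (40 * (k * (k + 8)).+1)%N; pose c2 := ((2 ^ k).+1 * s)%N.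
exists (search (trial_expr k)).
exists (word_exp k + deg (word_exp k) (trial_expr k) + c1 + c2)%N.
set c := (_ + _ + c1 + c2)%N.
move=> D U Delta D_U Delta_ge; set N := dbsize D in Delta_ge *.
set beta : R := N%:R / Delta.
have D_ge0 := Delta_ge0 _ _ _ Delta_ge.
have [|||||||||||M [size_M lt_M ans_M]] := @data_structure k D U (Num.truncn Delta)
  (Num.truncn beta).+1 (Num.truncn (Num.sqrt beta)).+1 (Num.truncn (N%:R * Delta)) c hk D_U.
- by [].
- by [].
- exact: leq_trunc_sqr.
- by have := trunc_sqrt_le _ _ _ Delta_ge; rewrite -/N -/beta; lia.
- by have := trunc_beta_le _ _ _ Delta_ge; rewrite -/N -/beta; lia.
- exact: leN_trunc.
- exact: light_trunc.
- exact: heavy_trunc.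
- exact: pairs_trunc.
- by rewrite /c; lia.
- by rewrite /c; lia.
exists M; split.
- have Z_le : (Num.truncn (N%:R * Delta))%:R <= N%:R * Delta :> R.
    by rewrite truncn_le mulr_ge0.
  apply: (@le_trans _ _ (c1%:R * (1 + N%:R * Delta))); last first.
    by rewrite ler_wpM2r ?addr_ge0 ?mulr_ge0 // ler_nat /c; lia.
  apply: (@le_trans _ _ (c1 * (1 + Num.truncn (N%:R * Delta)))%:R).
    rewrite ler_nat (leq_trans size_M) // /c1 -mulnA leq_mul2l /=; nia.
  by rewrite natrM natrD ler_wpM2l // lerD2l.
- move=> v /(allP lt_M) /= lt_v; apply: leq_trans lt_v _.
  by rewrite /word_bound leq_pexp2l /c; lia.
move=> a b lt_a lt_b; have [t le_t ans_t] := ans_M a b lt_a lt_b.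
exists t; split=> //; set p := beta `^ _.
have p_ge0 : 0 <= p by apply: powR_ge0.
apply: (@le_trans _ _ (c2%:R * (1 + p))); last first.
  by rewrite ler_wpM2r ?addr_ge0 // ler_nat /c; lia.
have T_le := trials_le _ _ _ Delta_ge k hk.
rewrite -/beta -/p in T_le.
apply: le_trans (_ : ((_ * _).+1 * s)%N%:R <= _); first by rewrite ler_nat; exact: le_t.
rewrite /c2 !natrM mulrAC ler_wpM2r // -!natr1.
by rewrite mulrDl mul1r lerD ?lerDl // -natrM.
Qed.
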